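(* There is a randomized algorithm that takes as input a DAG $G$ on $n$ nodes, two Bayes nets $P$ and $Q$ over $G$ with alphabet $[\ell]$ (given by their CPTs), and parameters $\varepsilon,\delta>0$, and behaves as follows. The algorithm makes probabilistic inference queries for a Bayes net over the same DAG $G$ with alphabet size $\ell^2$, and with probability at least $1-\delta$ outputs a $(1+\varepsilon)$-relative approximation of $d_{\mathrm{TV}}(P,Q)$, i.e., a value $v$ with $d_{\mathrm{TV}}(P,Q)/(1+\varepsilon)\le v\le(1+\varepsilon)\,d_{\mathrm{TV}}(P,Q)$. Its running time is $T(G,\ell^2)\cdot O(n^3\varepsilon^{-2}\ell\log\delta^{-1})$ and it makes $O(n^3\varepsilon^{-2}\ell\log\delta^{-1})$ probabilistic inference queries, where $T(G,\ell^2)$ denotes the running time of an implementation of probabilistic inference for Bayes nets over $G$ with alphabet size $\ell^2$.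
   Context: A Bayes net over a DAG $G$ with vertex set $[n]$ and alphabet $[\ell]$ associates to each vertex $i$ a random variable $X_i$ with range $[\ell]$ and a conditional probability table (CPT) giving $\Pr[X_i=x\mid X_{\Pi(i)}=y]$ for every $x\in[\ell]$ and every assignment $y$ to the parents $\Pi(i)$ of $i$; its distribution is $P(x)=\prod_{i=1}^n \Pr[X_i=x_i\mid X_{\Pi(i)}=x_{\Pi(i)}]$ for $x\in[\ell]^n$. Probabilities are rational numbers. The total variation distance of distributions $P,Q$ on a finite set $\mathcal D$ is $d_{\mathrm{TV}}(P,Q)=\max_{S\subseteq\mathcal D}(P(S)-Q(S))=\sum_{w}\max(0,P(w)-Q(w))$. A probabilistic inference query takes a description of a Bayes net $B$ over variables $X_1,\dots,X_n$ with alphabet $[\ell']$ and sets $S_1,\dots,S_n\subseteq[\ell']$, and returns $\Pr_B[X_1\in S_1,\dots,X_n\in S_n]$.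
   Formalization: In the O-bounds, ε^{-2} and log δ^{-1} are read as max(1, ε^{-2}) and max(1, ln δ^{-1}), since the literal bound is zero or negative for δ ≥ 1 and tends to 0 as ε grows; n ≥ 1, ε and δ are rational, and T(G,ℓ²) is at least the length of a query. *)

(* Defs.v *)
From Stdlib Require List.
From mathcomp Require Import all_boot all_order all_algebra.
From mathcomp Require Import reals exp.

Set Implicit Arguments.
Unset Strict Implicit.
Unset Printing Implicit Defensive.

Import Order.TTheory GRing.Theory Num.Theory.
Local Open Scope ring_scope.

(******************************************************************************)
(* In Bayes nets, the nodes are 0, ..., n - 1 and the alphabet of size l is   *)
(* 0, ..., l - 1.                                                             *)
(******************************************************************************)

Record dag (n : nat) := Dag {
  edge : rel 'I_n;
  edge_acyclic : forall i j, edge i j -> ~~ connect edge j i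
}.

Definition parents n (G : dag n) (i : 'I_n) : {set 'I_n} :=
  [set j | edge G j i].

(* The parents of i are listed in increasing order by enum_val, so that an    *)
(* assignment to them is a function y on 'I_#|parents G i|.                   *)
Definition passign n (G : dag n) (l : nat) (i : 'I_n) :=
  {ffun 'I_#|parents G i| -> 'I_l}.

Definition restrict n (G : dag n) l (x : {ffun 'I_n -> 'I_l}) (i : 'I_n) :
    passign G l i :=
  [ffun k => x (enum_val k)].

Record bayes_net n (G : dag n) (l : nat) := BayesNet {
  cpt : forall i : 'I_n, passign G l i -> 'I_l -> rat;
  cpt_ge0 : forall i (y : passign G l i) x, 0 <= cpt y x;
  cpt_sum1 : forall i (y : passign G l i), \sum_x cpt y x = 1
}.

Definition bn_prob n (G : dag n) l (B : bayes_net G l)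
    (x : {ffun 'I_n -> 'I_l}) : rat :=
  \prod_i cpt B (restrict G x i) (x i).

(* The default value 0 of the maximum is also the value at S = set0.          *)
Definition dTV (D : finType) (P Q : D -> rat) : rat :=
  \big[Num.max/0]_(S : {set D}) (\sum_(w in S) P w - \sum_(w in S) Q w).

Lemma dTVE (D : finType) (P Q : D -> rat) :
  dTV P Q = \sum_w Num.max 0 (P w - Q w).
Proof.
apply/eqP; rewrite eq_le; apply/andP; split.
  apply/bigmax_leP; split=> [|S _].
    by apply: sumr_ge0 => w _; rewrite le_max lexx.
  rewrite -sumrB big_mkcond /=; apply: ler_sum => w _.
  by case: ifP => _; rewrite le_max lexx ?orbT.
pose S := [set w | Q w < P w].
have -> : \sum_w Num.max 0 (P w - Q w)
        = \sum_(w in S) P w - \sum_(w in S) Q w.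
  rewrite -sumrB [RHS]big_mkcond /=; apply: eq_bigr => w _.
  by rewrite inE -subr_gt0 /Num.max.
exact: (le_bigmax_cond _ (fun S : {set D} =>
  \sum_(w in S) P w - \sum_(w in S) Q w)).
Qed.

Definition inference n (G : dag n) m (B : bayes_net G m)
    (S : 'I_n -> {set 'I_m}) : rat :=
  \sum_(x : {ffun 'I_n -> 'I_m} | [forall i, x i \in S i]) bn_prob B x.

(******************************************************************************)
(* Randomized algorithms: programs of a unit-cost random access machine over  *)
(* the rationals.  Memory consists of two-dimensional arrays of natural       *)
(* numbers and of rationals, each array being named by a number fixed in the  *)
(* program text; scalars are kept in cell (0, 0).  Only natural numbers can   *)
(* be used as indices, and there is no conversion (such as floor) from        *)
(* rationals to naturals.                                                     *)
(******************************************************************************)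

Record memory := Memory {
  nmem : nat -> nat -> nat -> nat;
  rmem : nat -> nat -> nat -> rat
}.

Inductive nexp :=
| NConst of nat
| NGet of nat & nexp & nexp
| NAdd of nexp & nexp
| NSub of nexp & nexp
| NMul of nexp & nexp.

Inductive rexp :=
| ROfNat of nexp
| RGet of nat & nexp & nexp
| RAdd of rexp & rexp
| RSub of rexp & rexp
| RMul of rexp & rexp
| RDiv of rexp & rexp.

Inductive bexp :=
| BLeN of nexp & nexp
| BLeR of rexp & rexp
| BNot of bexp
| BAnd of bexp & bexp.

(* Flip a i j p writes 1 with probability p, and 0 otherwise, in cell (i, j)  *)
(* of array a of naturals.  Query a i j asks for the answer to the inference  *)
(* query described in memory (see query_mem) and writes it in cell (i, j) of  *)
(* array a of rationals.                                                      *)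
Inductive cmd :=
| Skip
| SetN of nat & nexp & nexp & nexp
| SetR of nat & nexp & nexp & rexp
| Flip of nat & nexp & nexp & rexp
| Query of nat & nexp & nexp
| Seq of cmd & cmd
| If of bexp & cmd & cmd
| While of bexp & cmd.

Fixpoint neval (s : memory) (e : nexp) : nat :=
  match e with
  | NConst k => k
  | NGet a i j => nmem s a (neval s i) (neval s j)
  | NAdd e1 e2 => (neval s e1 + neval s e2)%N
  | NSub e1 e2 => (neval s e1 - neval s e2)%N
  | NMul e1 e2 => (neval s e1 * neval s e2)%N
  end.

Fixpoint reval (s : memory) (e : rexp) : rat :=
  match e with
  | ROfNat e1 => (neval s e1)%:R
  | RGet a i j => rmem s a (neval s i) (neval s j)
  | RAdd e1 e2 => reval s e1 + reval s e2
  | RSub e1 e2 => reval s e1 - reval s e2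
  | RMul e1 e2 => reval s e1 * reval s e2
  | RDiv e1 e2 => reval s e1 / reval s e2
  end.

Fixpoint beval (s : memory) (b : bexp) : bool :=
  match b with
  | BLeN e1 e2 => (neval s e1 <= neval s e2)%N
  | BLeR e1 e2 => reval s e1 <= reval s e2
  | BNot b1 => ~~ beval s b1
  | BAnd b1 b2 => beval s b1 && beval s b2
  end.

Definition upd (V : Type) (f : nat -> nat -> nat -> V) (a i j : nat) (v : V) :=
  fun a' i' j' => if [&& a' == a, i' == i & j' == j] then v else f a' i' j'.

Definition set_nat (s : memory) a i j (v : nat) :=
  Memory (upd (nmem s) a i j v) (rmem s).

Definition set_rat (s : memory) a i j (v : rat) :=
  Memory (nmem s) (upd (rmem s) a i j v).

(* Row index, in the table of a node, of an assignment to its parents.        *)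
Definition row_index d m (y : {ffun 'I_d -> 'I_m}) : nat :=
  (\sum_(k < d) y k * m ^ k)%N.

Definition net_mem n (G : dag n) m (a : nat) (B : bayes_net G m)
    (s : memory) : Prop :=
  forall (i : 'I_n) (y : passign G m i) (x : 'I_m),
    rmem s a i (row_index y * m + x)%N = cpt B y x.

(* Arrays of naturals (n, l, npar, par, qset) and arrays of rationals (P, Q,  *)
(* eps, del, qnet, out) have separate name spaces.                            *)
Definition arr_n := 0%N.
Definition arr_l := 1%N.
Definition arr_npar := 2%N.
Definition arr_par := 3%N.
Definition arr_qset := 4%N.
Definition arr_P := 0%N.
Definition arr_Q := 1%N.
Definition arr_eps := 2%N.
Definition arr_del := 3%N.
Definition arr_qnet := 4%N.
Definition arr_out := 5%N.

(* Cells other than those mentioned have arbitrary contents.                  *)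
Record input_mem n (G : dag n) l (P Q : bayes_net G l) (eps del : rat)
    (s : memory) : Prop := InputMem {
  input_n : nmem s arr_n 0 0 = n;
  input_l : nmem s arr_l 0 0 = l;
  input_npar : forall i : 'I_n, nmem s arr_npar i 0 = #|parents G i|;
  input_par : forall (i : 'I_n) (k : 'I_#|parents G i|),
    nmem s arr_par i k = enum_val k;
  input_P : net_mem arr_P P s;
  input_Q : net_mem arr_Q Q s;
  input_eps : rmem s arr_eps 0 0 = eps;
  input_del : rmem s arr_del 0 0 = del
}.

Definition query_mem n (G : dag n) m (B : bayes_net G m)
    (S : 'I_n -> {set 'I_m}) (s : memory) : Prop :=
  net_mem arr_qnet B s /\
  forall (i : 'I_n) (x : 'I_m), (x \in S i) = (nmem s arr_qset i x != 0%N).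

(* Length of the description of a query: all table entries of the Bayes net,  *)
(* and a membership bit for each node and letter (see query_mem).             *)
Definition query_size n (G : dag n) (m : nat) : nat :=
  (\sum_(i < n) (m ^ #|parents G i|.+1 + m))%N.

(* Finitely supported distributions, as lists of weighted outcomes.           *)
Definition dist (A : Type) := seq (rat * A).

Definition dbind (A B : Type) (mu : dist A) (f : A -> dist B) : dist B :=
  [seq (o.1 * o'.1, o'.2) | o <- mu, o' <- f o.2].

Definition dprob (A : Type) (mu : dist A) (E : pred A) : rat :=
  \sum_(o <- mu | E o.2) o.1.

Definition dall (A : Type) (mu : dist A) (E : A -> Prop) : Prop :=
  forall o, List.In o mu -> E o.2.

(* Branches of probability 0 are discarded.                                   *)
Definition dflip (A : Type) (p : rat) (x y : A) : dist A :=
  [seq o <- [:: (p, x); (1 - p, y)] | o.1 != 0].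

Record config := Config {
  mem_of : memory;
  steps : nat;
  queries : nat
}.

Definition start (s : memory) := Config s 0 0.

Definition step_to (c : config) (s : memory) :=
  Config s (steps c).+1 (queries c).

Definition query_to (c : config) (s : memory) :=
  Config s (steps c) (queries c).+1.

Definition output (c : config) : rat := rmem (mem_of c) arr_out 0 0.

(* Each query is charged t time units.                                        *)
Definition running_time (t : nat) (c : config) : nat :=
  (steps c + queries c * t)%N.

(* eval G m p c mu: started in c, with access to an oracle for inference over *)
(* G with alphabet size m, p halts on every random outcome, and mu is the     *)
(* distribution of the final configuration.  There is no derivation if a      *)
(* positive-probability run diverges, flips with a bias outside [0, 1], or    *)
(* queries with a table that is not that of a Bayes net.  Every executed      *)
(* assignment, flip and test counts as one step: the expressions involved     *)
(* have a size bounded by the program text.                                   *)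
Inductive eval n (G : dag n) (m : nat) : cmd -> config -> dist config -> Prop :=
| eval_Skip c : eval G m Skip c [:: (1, c)]
| eval_SetN a i j e c :
    let s := mem_of c in
    eval G m (SetN a i j e) c
      [:: (1, step_to c (set_nat s a (neval s i) (neval s j) (neval s e)))]
| eval_SetR a i j e c :
    let s := mem_of c in
    eval G m (SetR a i j e) c
      [:: (1, step_to c (set_rat s a (neval s i) (neval s j) (reval s e)))]
| eval_Flip a i j e c :
    let s := mem_of c in
    0 <= reval s e <= 1 ->
    eval G m (Flip a i j e) c
      (dflip (reval s e)
         (step_to c (set_nat s a (neval s i) (neval s j) 1))
         (step_to c (set_nat s a (neval s i) (neval s j) 0)))
| eval_Query a i j c (B : bayes_net G m) (S : 'I_n -> {set 'I_m}) :
    let s := mem_of c in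
    query_mem B S s ->
    eval G m (Query a i j) c
      [:: (1, query_to c
                (set_rat s a (neval s i) (neval s j) (inference B S)))]
| eval_Seq p1 p2 c mu nu :
    eval G m p1 c mu ->
    (forall o, List.In o mu -> eval G m p2 o.2 (nu o.2)) ->
    eval G m (Seq p1 p2) c (dbind mu nu)
| eval_IfTrue b p1 p2 c mu :
    beval (mem_of c) b ->
    eval G m p1 (step_to c (mem_of c)) mu ->
    eval G m (If b p1 p2) c mu
| eval_IfFalse b p1 p2 c mu :
    ~~ beval (mem_of c) b ->
    eval G m p2 (step_to c (mem_of c)) mu ->
    eval G m (If b p1 p2) c mu
| eval_WhileTrue b p c mu :
    beval (mem_of c) b ->
    eval G m (Seq p (While b p)) (step_to c (mem_of c)) mu ->
    eval G m (While b p) c mu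
| eval_WhileFalse b p c :
    ~~ beval (mem_of c) b ->
    eval G m (While b p) c [:: (1, step_to c (mem_of c))].

(* The function n^3 eps^-2 l log(1/del) inside the O.  The truncations at 1   *)
(* matter only for eps > 1 or del > 1/e: there the untruncated product tends  *)
(* to 0 (or is negative), and cannot bound the cost of any algorithm.         *)
Definition cost_bound (R : realType) (n l : nat) (eps del : rat) : R :=
  n%:R ^+ 3 * Num.max 1 (ratr eps ^- 2) * l%:R * Num.max 1 (ln (ratr del)^-1).

(* Main.v *)
(* Let excess x = P x - prod_i min(P_i, Q_i), where P_i and Q_i are the CPT   *)

(* Let Z be the sum of all [excess x]. As max(0, P x - Q x) <= [excess x], a word drawn with
   probability [excess x] / Z can be accepted with probability max(0, P x - Q x) / [excess x];
   acceptance is then a coin of bias p = dTV / Z ([wp_sample]). Estimating p by its frequency is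
   cheap only if p is not too small, and p >= 1 / (2 n) is the crux ([sum_excess_le]). Adding a node
   i to an ancestral set D raises the total excess by terms u (1 - sum_a min(P_i, Q_i)), u being the
   product of the minima over D. By [overlap_step] this is at most the L1 distance of the marginals
   on D + i. Such distances only grow with D, so n increments give Z <= n sum |P - Q| = 2 n dTV.

   Drawing the word needs the excess of all words with a given prefix. Both P and the product of the
   minima are masses of product events under [coupled], hence two queries suffice
   ([sum_excess_inference]). Letters are fixed one at a time by accept or reject coins. The
   conditional mean of any function of the final word is a martingale of this walk ([wp_walk_step]),
   which determines the law of the word ([wp_sample_word]).

   The number X of acceptances in M trials is likewise known only through expected values: E b^X =
   (1 - p + p b)^M for all rational b ([wp_estimate]). This is all that [chernoff] needs, and
   [estimate_accuracy] turns the two tails into a relative error. For the cost, a trial has at most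
   n l walk steps of two queries each, and the remaining work is absorbed by T, which is at least
   the query size ([running_time_bound]). *)
(* entries selected by the word x.  Then max(0, P x - Q x) <= excess x, and   *)
(* summing out the nodes one at a time, children before parents, shows that   *)
(* Z = sum_x excess x is at most 2 n dTV(P, Q).  Both products in excess x    *)
(* come from a single Bayes net over the alphabet of size l ^ 2, whose        *)
(* letters carry a flag telling apart min(P_i, Q_i) and P_i - min(P_i, Q_i);  *)
(* two inference queries therefore give the total excess of all words with a  *)
(* given prefix.  This allows to draw x with probability excess x / Z, letter *)
(* by letter; accepting x with probability max(0, P x - Q x) / excess x is a  *)
(* coin of bias dTV(P, Q) / Z >= 1 / (2 n), and Z times the frequency of      *)
(* acceptance in M = 64 n j^2 (e + 1) trials is the estimate, where j and e   *)
(* are least such that j eps >= 1 and 2^e del >= 1.                           *)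
Require Import Defs.
From mathcomp Require Import all_boot all_order all_algebra.
From mathcomp Require Import boolp reals sequences exp.
From mathcomp Require Import zify ring lra.

Set Implicit Arguments.
Unset Strict Implicit.
Unset Printing Implicit Defensive.

Import Order.TTheory GRing.Theory Num.Theory.
Local Open Scope ring_scope.

(** * A program logic for expected values *)

Section ProgramLogic.
Variables (n : nat) (G : dag n) (m : nat).

Lemma eq_big_In (A : Type) (s : seq A) (F1 F2 : A -> rat) :
  (forall o, List.In o s -> F1 o = F2 o) ->
  \sum_(o <- s) F1 o = \sum_(o <- s) F2 o.
Proof.
elim: s => [|a s IHs] eqF; first by rewrite !big_nil.
by rewrite !big_cons eqF ?IHs //=; [move=> o so; apply: eqF; right | left].
Qed.

Lemma In_dbind (A B : Type) (mu : dist A) (f : A -> dist B) o :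
  List.In o (dbind mu f) -> exists o1 o2, [/\ List.In o1 mu,
    List.In o2 (f o1.2) & o = (o1.1 * o2.1, o2.2)].
Proof.
rewrite /dbind; elim: mu => [|a mu IHmu] //= oin.
have {oin} := oin.
case/List.in_app_iff=> [/List.in_map_iff[o2 [<- ?]]|/IHmu[o1 [o2 [? ? ->]]]].
  by exists a, o2; split=> //; left.
by exists o1, o2; split=> //; right.
Qed.

Lemma big_dbind (A B : Type) (mu : dist A) (f : A -> dist B) (F : B -> rat) :
  \sum_(o <- dbind mu f) o.1 * F o.2 =
  \sum_(o <- mu) o.1 * \sum_(o' <- f o.2) o'.1 * F o'.2.
Proof.
rewrite /dbind big_allpairs_dep; apply: eq_bigr => o _.
by rewrite mulr_sumr; apply: eq_bigr => o' _; rewrite mulrA.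
Qed.

Lemma total_massE (A : Type) (mu : dist A) :
  \sum_(o <- mu) o.1 = \sum_(o <- mu) o.1 * (fun=> 1) o.2.
Proof. by apply: eq_bigr => o _; rewrite mulr1. Qed.

(* wp p s K Q Psi phi v: from memory s, program p halts almost surely in a    *)
(* memory satisfying Psi, after at most K steps and Q queries, and phi i has  *)
(* expected value v i in the final memory, for every i simultaneously.        *)
Definition wp I (p : cmd) (s : memory) (K Q : nat) (Psi : memory -> Prop)
    (phi : I -> memory -> rat) (v : I -> rat) : Prop :=
  forall t q, exists mu,
    [/\ eval G m p (Config s t q) mu,
        forall o, List.In o mu -> [/\ 0 <= o.1, Psi (mem_of o.2),
          (steps o.2 <= t + K)%N & (queries o.2 <= q + Q)%N],
        \sum_(o <- mu) o.1 = 1 &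
        forall i, \sum_(o <- mu) o.1 * phi i (mem_of o.2) = v i].

(** The empty index type leaves no expected value to track. *)
Definition hoare p s K Q Psi :=
  wp p s K Q Psi (fun (_ : void) _ => 0) (fun _ => 0).

Lemma wp_weaken I p s K Q K' Q' (Psi Psi' : memory -> Prop)
    (phi phi' : I -> memory -> rat) v v' :
  wp p s K Q Psi phi v -> (K <= K')%N -> (Q <= Q')%N ->
  (forall s', Psi s' -> Psi' s') ->
  (forall i s', Psi s' -> phi i s' = phi' i s') -> v =1 v' ->
  wp p s K' Q' Psi' phi' v'.
Proof.
move=> wpp leK leQ impl eqphi eqv t q.
have [mu [ev all mu1 Emu]] := wpp t q; exists mu; split=> // [o /all[? ? ? ?]|i].
  split; [by []|exact: impl|lia|lia].
rewrite -eqv -Emu; apply: eq_big_In => o /all[_ ? _ _].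
by rewrite eqphi.
Qed.

Lemma wp_cost I p s K Q K' Q' (Psi : memory -> Prop) (phi : I -> memory -> rat) v :
  wp p s K Q Psi phi v -> (K <= K')%N -> (Q <= Q')%N -> wp p s K' Q' Psi phi v.
Proof. by move=> wpp leK leQ; apply: (wp_weaken wpp). Qed.

Lemma hoare_weaken p s K Q K' Q' (Psi Psi' : memory -> Prop) :
  hoare p s K Q Psi -> (K <= K')%N -> (Q <= Q')%N ->
  (forall s', Psi s' -> Psi' s') -> hoare p s K' Q' Psi'.
Proof. by move=> hp leK leQ impl; apply: (wp_weaken hp). Qed.

Lemma hoare_wp I p s K Q Psi (v : I -> rat) :
  hoare p s K Q Psi -> wp p s K Q Psi (fun i _ => v i) v.
Proof.
move=> hp t q; have [mu [ev all mu1 _]] := hp t q; exists mu; split=> // i.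
by rewrite -mulr_suml mu1 mul1r.
Qed.

Lemma wp_seq I p1 p2 s K1 Q1 K2 Q2 Psi1 Psi2 (phi1 phi2 : I -> memory -> rat) v :
  wp p1 s K1 Q1 Psi1 phi1 v ->
  (forall s1, Psi1 s1 -> wp p2 s1 K2 Q2 Psi2 phi2 (phi1^~ s1)) ->
  wp (Seq p1 p2) s (K1 + K2) (Q1 + Q2) Psi2 phi2 v.
Proof.
move=> wp1 wp2 t q; have [mu [ev1 all1 mu1 Emu]] := wp1 t q.
(* [eval_Seq] wants the continuations as one function of the configuration, hence the use of
   [choice]; outside [Psi1] any value will do. *)
pose post (c : config) nu := Psi1 (mem_of c) ->
  [/\ eval G m p2 c nu,
      forall o, List.In o nu -> [/\ 0 <= o.1, Psi2 (mem_of o.2),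
        (steps o.2 <= steps c + K2)%N & (queries o.2 <= queries c + Q2)%N],
      \sum_(o <- nu) o.1 = 1 &
      forall i, \sum_(o <- nu) o.1 * phi2 i (mem_of o.2) = phi1 i (mem_of c)].
have /choice[nu nuP] : forall c, exists nu, post c nu.
  move=> [s1 t1 q1]; have [Psi1s|nPsi] := pselect (Psi1 s1); last by exists [::].
  by have [nu nuP] := wp2 _ Psi1s t1 q1; exists nu.
exists (dbind mu nu); split=> [|o||i].
- by apply: eval_Seq => // o /all1[_ /nuP[]].
- move=> /In_dbind[o1 [o2 [/all1[? /nuP[_ all2 _ _] ? ?] /all2[? ? ? ?] ->]]].
  by split=> /=; [exact: mulr_ge0|by []|lia|lia].
- rewrite -[RHS]mu1 total_massE (big_dbind _ _ (fun=> 1)); apply: eq_big_In => o.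
  by move=> /all1[_ /nuP[_ _ nu1 _] _ _]; rewrite -total_massE nu1 mulr1.
- rewrite (big_dbind _ _ (fun c => phi2 i (mem_of c))) -Emu; apply: eq_big_In => o.
  by move=> /all1[_ /nuP[_ _ _ ->]].
Qed.

Lemma hoare_seq I p1 p2 s K1 Q1 K2 Q2 Psi1 Psi2 (phi2 : I -> memory -> rat) v :
  hoare p1 s K1 Q1 Psi1 ->
  (forall s1, Psi1 s1 -> wp p2 s1 K2 Q2 Psi2 phi2 v) ->
  wp (Seq p1 p2) s (K1 + K2) (Q1 + Q2) Psi2 phi2 v.
Proof. by move=> /(@hoare_wp _ _ _ _ _ _ v) /wp_seq; apply. Qed.

Lemma wp_skip I s (Psi : memory -> Prop) (phi : I -> memory -> rat) :
  Psi s -> wp Skip s 0 0 Psi phi (phi^~ s).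
Proof.
move=> Psis t q; exists [:: (1, Config s t q)]; split=> [|o /= [<-|//]||i].
- exact: eval_Skip.
- by split=> //=; lia.
- by rewrite big_seq1.
- by rewrite big_seq1 mul1r.
Qed.

Lemma wp_setn I a i j e s (Psi : memory -> Prop) (phi : I -> memory -> rat) v :
  let s' := set_nat s a (neval s i) (neval s j) (neval s e) in
  Psi s' -> phi^~ s' =1 v -> wp (SetN a i j e) s 1 0 Psi phi v.
Proof.
move=> s' Psis' phiv t q; exists [:: (1, Config s' t.+1 q)].
split=> [|o /= [<-|//]||k].
- exact: (@eval_SetN _ G m a i j e (Config s t q)).
- by split=> //=; lia.
- by rewrite big_seq1.
- by rewrite big_seq1 mul1r -phiv.
Qed.

Lemma wp_setn_conj I a i j e s (Psi : memory -> Prop) (phi : I -> memory -> rat) v :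
  let s' := set_nat s a (neval s i) (neval s j) (neval s e) in
  Psi s' /\ phi^~ s' =1 v -> wp (SetN a i j e) s 1 0 Psi phi v.
Proof. by move=> s' []; exact: wp_setn. Qed.

Lemma wp_setr I a i j e s (Psi : memory -> Prop) (phi : I -> memory -> rat) v :
  let s' := set_rat s a (neval s i) (neval s j) (reval s e) in
  Psi s' -> phi^~ s' =1 v -> wp (SetR a i j e) s 1 0 Psi phi v.
Proof.
move=> s' Psis' phiv t q; exists [:: (1, Config s' t.+1 q)].
split=> [|o /= [<-|//]||k].
- exact: (@eval_SetR _ G m a i j e (Config s t q)).
- by split=> //=; lia.
- by rewrite big_seq1.
- by rewrite big_seq1 mul1r -phiv.
Qed.

Lemma wp_setn_seq I a i j e p s K Q Psi (phi : I -> memory -> rat) v :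
  wp p (set_nat s a (neval s i) (neval s j) (neval s e)) K Q Psi phi v ->
  wp (Seq (SetN a i j e) p) s K.+1 Q Psi phi v.
Proof.
move=> wpp.
apply: (@hoare_seq _ _ _ _ 1 0 _ _ (eq (set_nat s a (neval s i) (neval s j)
  (neval s e)))) => [|_ <-//].
exact: wp_setn.
Qed.

Lemma wp_setr_seq I a i j e p s K Q Psi (phi : I -> memory -> rat) v :
  wp p (set_rat s a (neval s i) (neval s j) (reval s e)) K Q Psi phi v ->
  wp (Seq (SetR a i j e) p) s K.+1 Q Psi phi v.
Proof.
move=> wpp.
apply: (@hoare_seq _ _ _ _ 1 0 _ _ (eq (set_rat s a (neval s i) (neval s j)
  (reval s e)))) => [|_ <-//].
exact: wp_setr.
Qed.

Lemma hoare_query a i j s (B : bayes_net G m) S :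
  query_mem B S s ->
  hoare (Query a i j) s 0 1
    (eq (set_rat s a (neval s i) (neval s j) (inference B S))).
Proof.
move=> sBS t q; exists [:: (1, Config (set_rat s a (neval s i) (neval s j)
  (inference B S)) t q.+1)].
split=> [|o /= [<-|//]||//].
- by refine (@eval_Query _ G m a i j (Config s t q) B S _).
- by split=> //=; lia.
- by rewrite big_seq1.
Qed.

(** Sides of probability 0 are absent from the outcome, so each branch may assume its probability
    nonzero. The sampler relies on this to keep its remaining mass positive. *)
Lemma wp_flip_seq I a i j e p s K Q Psi (phi : I -> memory -> rat) v v1 v0 :
  let r := reval s e in
  0 <= r <= 1 ->
  (r != 0 -> wp p (set_nat s a (neval s i) (neval s j) 1) K Q Psi phi v1) ->
  (1 - r != 0 -> wp p (set_nat s a (neval s i) (neval s j) 0) K Q Psi phi v0) ->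
  (forall k, v k = r * v1 k + (1 - r) * v0 k) ->
  wp (Seq (Flip a i j e) p) s K.+1 Q Psi phi v.
Proof.
move=> r r01 wp1 wp0 vE.
set s1 := set_nat s a (neval s i) (neval s j) 1 in wp1.
set s0 := set_nat s a (neval s i) (neval s j) 0 in wp0.
pose Psi1 s' := (r != 0 /\ s' = s1) \/ (1 - r != 0 /\ s' = s0).
(* The coin is read back from the cell just written, to know which mean applies. *)
pose phi1 k s' := if nmem s' a (neval s i) (neval s j) == 1%N then v1 k else v0 k.
have phi1_s1 k : phi1 k s1 = v1 k by rewrite /phi1 /= /upd !eqxx.
have phi1_s0 k : phi1 k s0 = v0 k by rewrite /phi1 /= /upd !eqxx.
apply: (@wp_seq _ _ _ _ 1 0 K Q Psi1 _ phi1) => [|s' [[rN0 ->]|[rN0 ->]]].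
- move=> t q; exists (dflip r (Config s1 t.+1 q) (Config s0 t.+1 q)).
  have big_flip F : \sum_(o <- dflip r (Config s1 t.+1 q) (Config s0 t.+1 q))
      o.1 * F o.2 = r * F (Config s1 t.+1 q) + (1 - r) * F (Config s0 t.+1 q).
    rewrite big_filter !big_mkcond !big_cons big_nil /= addr0.
    by do 2 case: eqP => [->|_]; rewrite ?mul0r.
  split=> [|o||k].
  + by refine (@eval_Flip _ G m a i j e (Config s t q) _).
  + have /andP[r0 r1] := r01.
    have o1 : r != 0 -> [/\ 0 <= r, Psi1 s1, (t.+1 <= t + 1)%N & (q <= q + 0)%N].
      by split=> //; [left|lia|lia].
    have o0 : 1 - r != 0 ->
        [/\ 0 <= 1 - r, Psi1 s0, (t.+1 <= t + 1)%N & (q <= q + 0)%N].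
      by split=> //; [lra|right|lia|lia].
    rewrite /dflip /=.
    by case: ifP => [/o1 ?|_]; case: ifP => [/o0 ?|_] //= [<-|] // [<-|].
  + by rewrite total_massE (big_flip (fun=> 1)); lra.
  + by rewrite (big_flip (fun c => phi1 k (mem_of c))) /= phi1_s1 phi1_s0.
- by apply: (wp_weaken (wp1 rN0)) => // k; rewrite phi1_s1.
- by apply: (wp_weaken (wp0 rN0)) => // k; rewrite phi1_s0.
Qed.

Lemma wp_if I b p1 p2 s K Q Psi (phi : I -> memory -> rat) v :
  (beval s b -> wp p1 s K Q Psi phi v) ->
  (~~ beval s b -> wp p2 s K Q Psi phi v) ->
  wp (If b p1 p2) s K.+1 Q Psi phi v.
Proof.
move=> wp1 wp2 t q; have [sb|nsb] := boolP (beval s b).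
  have [mu [ev all mu1 Emu]] := wp1 sb t.+1 q; exists mu; split=> //.
    exact: eval_IfTrue.
  by move=> o /all[? ? ? ?]; split=> //; lia.
have [mu [ev all mu1 Emu]] := wp2 nsb t.+1 q; exists mu; split=> //.
  exact: eval_IfFalse.
by move=> o /all[? ? ? ?]; split=> //; lia.
Qed.

(** The index of [J] bounds the number of iterations left, and [phi] is a martingale: one iteration
    preserves its mean. Each test costs one step, including the final failing one. *)
Lemma wp_while I b p s K Q (J : nat -> memory -> Prop)
    (phi : I -> memory -> rat) k :
  (forall k s, J k s -> beval s b ->
    exists2 k', k = k'.+1 & wp p s K Q (J k') phi (phi^~ s)) ->
  J k s ->
  wp (While b p) s (k * K.+1 + 1) (k * Q)
    (fun s' => ~~ beval s' b /\ exists k', J k' s') phi (phi^~ s).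
Proof.
move=> step; elim: k s => [|k IHk] s Js t q.
  have sb : ~~ beval s b by apply/negP => /(step _ _ Js)[].
  exists [:: (1, Config s t.+1 q)]; split=> [|o /= [<-|//]||i].
  - exact: eval_WhileFalse.
  - by split=> //=; [split=> //; exists 0%N|lia|lia].
  - by rewrite big_seq1.
  - by rewrite big_seq1 mul1r.
have [sb|sb] := boolP (beval s b); last first.
  exists [:: (1, Config s t.+1 q)]; split=> [|o /= [<-|//]||i].
  - exact: eval_WhileFalse.
  - by split=> //=; [split=> //; exists k.+1|lia|lia].
  - by rewrite big_seq1.
  - by rewrite big_seq1 mul1r.
have [_ [<-] wpp] := step _ _ Js sb.
have [mu [ev all mu1 Emu]] := wp_seq wpp IHk t.+1 q.
exists mu; split=> //; first exact: eval_WhileTrue.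
by move=> o /all[? ? ? ?]; split=> //; lia.
Qed.

End ProgramLogic.

(** * The excess and the total variation distance *)

Section Resampling.
Variables (n l : nat).
Implicit Types x : {ffun 'I_n -> 'I_l}.

Definition reassign x (i : 'I_n) (a : 'I_l) : {ffun 'I_n -> 'I_l} :=
  [ffun j => if j == i then a else x j].

(** Exchanging x i with a is an involution of the pairs (x, a). It lets a node be summed out among
    full words, at the price of a factor l, without words on subsets of nodes. *)
Lemma sum_resample (i : 'I_n) (F : {ffun 'I_n -> 'I_l} -> rat) :
  \sum_x \sum_a F (reassign x i a) = l%:R * \sum_x F x.
Proof.
rewrite pair_bigA /=.
pose swap (u : {ffun 'I_n -> 'I_l} * 'I_l) := (reassign u.1 i u.2, u.1 i).
have swapK : involutive swap.
  case=> x a; rewrite /swap /= ffunE eqxx; congr (_, _).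
  by apply/ffunP => j; rewrite !ffunE; case: eqP => // ->.
rewrite (reindex_inj (inv_inj swapK)) /=.
rewrite (eq_bigr (fun u => F u.1)) => [|u _]; last first.
  by have /(congr1 fst) /= -> := swapK u.
rewrite -(pair_bigA _ (fun x _ => F x)) mulr_sumr /=; apply: eq_bigr => x _.
by rewrite sumr_const card_ord mulr_natl.
Qed.

End Resampling.

Section BayesNets.
Variables (n : nat) (G : dag n).

Lemma notin_parents (i : 'I_n) : i \notin parents G i.
Proof.
by rewrite inE; apply/negP => Gii; have := edge_acyclic Gii; rewrite connect0.
Qed.

Lemma restrict_reassign l (x : {ffun 'I_n -> 'I_l}) i a j :
  i \notin parents G j -> restrict G (reassign x i a) j = restrict G x j.
Proof.
move=> ij; apply/ffunP => k; rewrite !ffunE; case: eqP => // ki.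
by move: (enum_valP k) ij; rewrite ki => ->.
Qed.

Definition ancestral (D : {set 'I_n}) :=
  forall i, i \in D -> parents G i \subset D.

(** Remove from an ancestral set a node with the most ancestors: an edge from it to another node of
    the set would give that node strictly more. What is left is again ancestral. *)
Lemma ancestral_ind (Pr : {set 'I_n} -> Prop) :
  Pr set0 ->
  (forall (i : 'I_n) (D : {set 'I_n}), i \notin D ->
     (forall j, j \in i |: D -> i \notin parents G j) ->
     Pr D -> Pr (i |: D)) ->
  Pr setT.
Proof.
move=> Pr0 PrU.
suff: forall D, ancestral D -> Pr D by apply=> i _; rewrite subsetT.
move=> D; have [k] := ubnP #|D|; elim: k D => // k IHk D ltDk ancD.
have [->//|[i0 i0D]] := set_0Vmem D.
pose anc (i : 'I_n) := #|[set j | connect (edge G) j i]|.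
have [i + imax] := @arg_maxnP _ i0 (mem D) anc i0D.
rewrite -[is_true _]/(is_true (i \in D)) => iD.
have sink j : j \in D -> i \notin parents G j.
  move=> jD; rewrite inE; apply/negP => ij.
  have : (anc j <= anc i)%N := imax j jD; rewrite leqNgt => /negP; apply.
  apply: proper_card; apply/properP; split.
    apply/subsetP => k'; rewrite !inE => /connect_trans; apply.
    exact: connect1.
  exists j; rewrite !inE ?connect0 //.
  exact: edge_acyclic.
rewrite -(setD1K iD) in sink *; apply: PrU => //; first by rewrite !inE eqxx.
have := cardsD1 i D; rewrite iD => cD.
apply: IHk => [|j]; first by lia.
rewrite !inE => /andP[ji jD]; apply/subsetP => k' k'j.
rewrite !inE (subsetP (ancD _ jD)) // andbT.
apply/eqP => k'i; move: (sink j); rewrite setD1K // jD => /(_ isT).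
by rewrite -k'i k'j.
Qed.

Variable l : nat.
Implicit Types (x : {ffun 'I_n -> 'I_l}) (P Q : bayes_net G l).

Definition factor P i x := cpt P (restrict G x i) (x i).
Definition min_factor P Q i x := Num.min (factor P i x) (factor Q i x).
Definition common P Q x := \prod_i min_factor P Q i x.
Definition excess P Q x := bn_prob P x - common P Q x.

Lemma factor_ge0 P i x : 0 <= factor P i x.
Proof. exact: cpt_ge0. Qed.

Lemma min_factor_ge0 P Q i x : 0 <= min_factor P Q i x.
Proof. by rewrite le_min !factor_ge0. Qed.

Lemma common_le P Q x : common P Q x <= bn_prob P x.
Proof.
by apply: ler_prod => i _; rewrite min_factor_ge0 /min_factor ge_min lexx.
Qed.

Lemma common_ler P Q x : common P Q x <= bn_prob Q x.
Proof.
by apply: ler_prod => i _; rewrite min_factor_ge0 /min_factor ge_min lexx orbT.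
Qed.

Lemma excess_ge0 P Q x : 0 <= excess P Q x.
Proof. by rewrite subr_ge0 common_le. Qed.

Lemma diff_le_excess P Q x :
  Num.max 0 (bn_prob P x - bn_prob Q x) <= excess P Q x.
Proof. by rewrite ge_max excess_ge0 lerD2l lerN2 common_ler. Qed.

Lemma prod_reassign (f : 'I_n -> {ffun 'I_n -> 'I_l} -> rat) i (D : {set 'I_n}) x a :
  i \notin D ->
  (forall j, j \in D -> f j (reassign x i a) = f j x) ->
  \prod_(j in i |: D) f j (reassign x i a) =
  f i (reassign x i a) * \prod_(j in D) f j x.
Proof.
by move=> iD fE; rewrite big_setU1 //=; congr (_ * _); apply: eq_bigr.
Qed.

Lemma factor_reassign P i (D : {set 'I_n}) j x a :
  i \notin D -> (forall j, j \in i |: D -> i \notin parents G j) ->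
  j \in D -> factor P j (reassign x i a) = factor P j x.
Proof.
move=> iD par jD; rewrite /factor restrict_reassign ?ffunE; last first.
  by apply: par; rewrite !inE jD orbT.
by case: eqP => // ji; rewrite -ji jD in iD.
Qed.

Lemma factor_reassign_eq P i x a :
  factor P i (reassign x i a) = cpt P (restrict G x i) a.
Proof.
by rewrite /factor restrict_reassign ?notin_parents // ffunE eqxx.
Qed.

Hypothesis l_gt0 : (0 < l)%N.

(** Comparing two nets, instead of computing the value 1, avoids tracking the powers of l caused by
    summing over full words. *)
Lemma sum_bn_prob P Q : \sum_x bn_prob P x = \sum_x bn_prob Q x.
Proof.
have prodT R : \sum_x bn_prob R x = \sum_x \prod_(i in setT) factor R i x.
  by apply: eq_bigr => x _; apply: eq_bigl => i; rewrite inE.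
rewrite !prodT.
apply: (@ancestral_ind (fun D => \sum_x \prod_(i in D) factor P i x =
  \sum_x \prod_(i in D) factor Q i x)) => [|i D iD par IHD].
  by under eq_bigr do rewrite big_set0; under [RHS]eq_bigr do rewrite big_set0.
have l0 : l%:R != 0 :> rat by rewrite pnatr_eq0 -lt0n.
have step R : \sum_x \sum_a \prod_(j in i |: D) factor R j (reassign x i a) =
    \sum_x \prod_(j in D) factor R j x.
  apply: eq_bigr => x _; rewrite -[RHS]mul1r.
  rewrite -[X in _ = X * _](cpt_sum1 R (restrict G x i)) mulr_suml.
  apply: eq_bigr => a _.
  rewrite (prod_reassign (f := factor R)) // ?factor_reassign_eq // => j jD.
  exact: factor_reassign jD.
by apply: (mulfI l0); rewrite -!(sum_resample i) !step.
Qed.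

(** Let q <= p, the other case being symmetric. Where g a < f a, one has p f a - q g a >= p (f a - g
    a) >= u (f a - g a), and these differences add up to 1 - sum_a min(f a, g a). *)
Lemma overlap_step (p q u : rat) (f g : 'I_l -> rat) :
  0 <= u -> u <= p -> u <= q ->
  (forall a, 0 <= f a) -> (forall a, 0 <= g a) ->
  \sum_a f a = 1 -> \sum_a g a = 1 ->
  u * (1 - \sum_a Num.min (f a) (g a)) <= \sum_a `|p * f a - q * g a|.
Proof.
wlog: p q f g / q <= p => [wl|qp] u0 up uq f0 g0 f1 g1.
  have [/wl|/ltW/wl] := leP q p; first exact.
  move=> /(_ g f u0 uq up g0 f0 g1 f1).
  under eq_bigr do rewrite minC.
  by under [X in _ <= X -> _]eq_bigr do rewrite distrC.
rewrite -f1 -sumrB mulr_sumr; apply: ler_sum => a _.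
have [fg|gf] := leP (f a) (g a); first by rewrite subrr mulr0.
apply: le_trans (ler_norm _).
have := f0 a; have := g0 a; nra.
Qed.

(** Ancestral induction on D. Write p and u for the products over D of the P_i and of the minima.
    Summing the letter of a new node out of its excess leaves p - u S = (p - u) + u (1 - S), with S
    the overlap of the two rows selected at that node; [overlap_step] bounds the second term. *)
Lemma sum_excess_le_norm P Q :
  \sum_x excess P Q x <= n%:R * \sum_x `|bn_prob P x - bn_prob Q x|.
Proof.
pose ex (D : {set 'I_n}) x :=
  \prod_(i in D) factor P i x - \prod_(i in D) min_factor P Q i x.
pose df (D : {set 'I_n}) x :=
  `|\prod_(i in D) factor P i x - \prod_(i in D) factor Q i x|.
have -> : \sum_x excess P Q x = \sum_x ex setT x.
  apply: eq_bigr => x _; rewrite /excess /ex.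
  by congr (_ - _); apply: eq_bigl => i; rewrite inE.
have -> : \sum_x `|bn_prob P x - bn_prob Q x| = \sum_x df setT x.
  apply: eq_bigr => x _; rewrite /df.
  by congr `|_ - _|; apply: eq_bigl => i; rewrite inE.
rewrite -[n in n%:R]card_ord -cardsT.
apply: (@ancestral_ind (fun D => \sum_x ex D x <= #|D|%:R * \sum_x df D x)).
  by rewrite cards0 mul0r big1 // => x _; rewrite /ex !big_set0 subrr.
move=> i D iD par IHD; rewrite cardsU1 iD /= natrD mulrDl mul1r.
have l0 : 0 < l%:R :> rat by rewrite ltr0n.
rewrite -(ler_pM2l l0) mulrDr mulrCA -!(sum_resample i).
have factorE R x a : \prod_(j in i |: D) factor R j (reassign x i a) =
    cpt R (restrict G x i) a * \prod_(j in D) factor R j x.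
  rewrite (prod_reassign (f := factor R)) // ?factor_reassign_eq // => j jD.
  exact: factor_reassign jD.
have minE x a : \prod_(j in i |: D) min_factor P Q j (reassign x i a) =
    Num.min (cpt P (restrict G x i) a) (cpt Q (restrict G x i) a) *
    \prod_(j in D) min_factor P Q j x.
  rewrite (prod_reassign (f := min_factor P Q)) ?[in LHS]/min_factor;
    rewrite ?factor_reassign_eq // => j jD.
  by rewrite /min_factor !(factor_reassign _ _ _ iD par jD).
(* Summing out a node does not increase the L1 distance. *)
have dfE x : df D x <= \sum_a df (i |: D) (reassign x i a).
  rewrite /df; under [X in _ <= X]eq_bigr do rewrite !factorE.
  apply: le_trans (ler_norm_sum _ _ _).
  by rewrite sumrB -!mulr_suml !cpt_sum1 !mul1r.
have exE x : \sum_a ex (i |: D) (reassign x i a) <=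
    ex D x + \sum_a df (i |: D) (reassign x i a).
  rewrite /ex /df.
  under [X in X <= _]eq_bigr do rewrite factorE minE.
  under [X in _ <= _ + X]eq_bigr do rewrite !factorE !(mulrC (cpt _ _ _)).
  rewrite sumrB -!mulr_suml cpt_sum1 mul1r.
  have := @overlap_step (\prod_(j in D) factor P j x)
    (\prod_(j in D) factor Q j x) (\prod_(j in D) min_factor P Q j x)
    (cpt P (restrict G x i)) (cpt Q (restrict G x i)).
  move=> /(_ _ _ _ (cpt_ge0 P _) (cpt_ge0 Q _) (cpt_sum1 P _) (cpt_sum1 Q _)).
  set u := \prod_(j in D) min_factor P Q j x.
  set S := \sum_a Num.min _ _; set V := \sum_a `|_|.
  move=> le_uV; suff : u * (1 - S) <= V by lra.
  apply: le_uV.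
  - by apply: prodr_ge0 => j _; exact: min_factor_ge0.
  - by apply: ler_prod => j _; rewrite min_factor_ge0 /min_factor ge_min lexx.
  - apply: ler_prod => j _.
    by rewrite min_factor_ge0 /min_factor ge_min lexx orbT.
apply: le_trans (ler_sum _ (fun x _ => exE x)) _.
rewrite big_split /= addrC lerD2l (le_trans IHD) // ler_wpM2l //.
exact: ler_sum.
Qed.

(** |r| = 2 max(0, r) - r, and the terms r cancel in total because both nets have the same mass. *)
Lemma sum_excess_le P Q :
  \sum_x excess P Q x <= 2 * n%:R * dTV (bn_prob P) (bn_prob Q).
Proof.
apply: le_trans (sum_excess_le_norm P Q) _.
rewrite [2 * _]mulrC -mulrA ler_wpM2l //.
have normE (r : rat) : `|r| = 2 * Num.max 0 r - r.
  by case: (ger0P r) => r0; lra.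
under eq_bigr do rewrite normE.
by rewrite sumrB -mulr_sumr -dTVE sumrB (sum_bn_prob P Q) subrr subr0.
Qed.

Lemma dTV_le_sum_excess P Q :
  dTV (bn_prob P) (bn_prob Q) <= \sum_x excess P Q x.
Proof. by rewrite dTVE; apply: ler_sum => x _; exact: diff_le_excess. Qed.

End BayesNets.

(** * The coupled Bayes net *)

Section CoupledNet.
Variables (n : nat) (G : dag n) (l : nat) (P Q : bayes_net G l).
Hypothesis l_gt0 : (0 < l)%N.

(* A letter z of the alphabet of size l ^ 2 stands for the letter z mod l     *)
(* together with a flag z / l: flag 0 carries the common part of P and Q, and *)
(* flag 1 the rest of P.  When l = 1 only flag 0 exists, but then P = Q.      *)
Definition low (z : 'I_(l ^ 2)) : 'I_l := Ordinal (ltn_pmod z l_gt0).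

Definition lows d (y : {ffun 'I_d -> 'I_(l ^ 2)}) : {ffun 'I_d -> 'I_l} :=
  [ffun k => low (y k)].

(** By truncated subtraction, 1 - a is the indicator of a = 0 and a (2 - a) that of a = 1, so that
    [fill_cell] evaluates the weight without branching on the flag. Flags from 2 on get weight 0. *)
Definition weight (a : nat) (p q : rat) : rat :=
  (1 - a)%N%:R * Num.min p q + (a * (2 - a))%N%:R * (p - Num.min p q).

Lemma flag_low_subproof (u : 'I_l * 'I_l) : (u.2 * l + u.1 < l ^ 2)%N.
Proof. by case: u => [[b bl] [a al]] /=; nia. Qed.

Lemma sum_low (F : nat -> 'I_l -> rat) :
  \sum_(z < l ^ 2) F (z %/ l)%N (low z) = \sum_b \sum_(a < l) F a b.
Proof.
rewrite pair_bigA /= (reindex (fun u => Ordinal (flag_low_subproof u))) /=.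
  apply: eq_bigr => -[b a] _ /=; rewrite divnMDl // divn_small // addn0.
  by congr F; apply: val_inj; rewrite /= modnMDl modn_small.
have flagP (z : 'I_(l ^ 2)) : (z %/ l < l)%N by rewrite ltn_divLR // mulnn.
exists (fun z : 'I_(l ^ 2) => (low z, Ordinal (flagP z))) => [[b a]|z] _ /=.
  congr (_, _); apply: val_inj; rewrite /= ?modnMDl ?modn_small //.
  by rewrite divnMDl // divn_small // addn0.
by apply: val_inj; rewrite /= -divn_eq.
Qed.

Lemma sum_low_eq (F : nat -> rat) (b : 'I_l) :
  \sum_(z < l ^ 2 | low z == b) F (z %/ l)%N = \sum_(a < l) F a.
Proof.
rewrite big_mkcond (sum_low (fun a b' => if b' == b then F a else 0)).
by rewrite (bigD1 b) //= eqxx [X in _ + X]big1 ?addr0 // => b' /negPf->;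
  rewrite big1.
Qed.

Lemma weight0 p q : weight 0 p q = Num.min p q.
Proof. by rewrite /weight mul0n mul0r addr0 mul1r. Qed.

Lemma weight1 p q : weight 1 p q = p - Num.min p q.
Proof. by rewrite /weight mul0r add0r mul1r. Qed.

Lemma weightSS a p q : weight a.+2 p q = 0.
Proof. by rewrite /weight !subSS !sub0n muln0 !mul0r addr0. Qed.

Lemma sum_weight p q : (l = 1%N -> p = q) -> \sum_(a < l) weight a p q = p.
Proof.
case: l l_gt0 => // -[|l'] _ pq; first by rewrite big_ord1 weight0 pq // minxx.
rewrite !big_ord_recl big1 => [|a _]; last exact: weightSS.
by rewrite weight0 weight1 addr0 addrC subrK.
Qed.

Lemma weight_ge0 a p q : 0 <= p -> 0 <= q -> 0 <= weight a p q.
Proof.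
move=> p0 q0; apply: addr_ge0; apply: mulr_ge0; rewrite ?ler0n ?le_min ?p0 //.
by rewrite subr_ge0 ge_min lexx.
Qed.

Lemma cpt_alphabet1 (R : bayes_net G l) i (y : passign G l i) b :
  l = 1%N -> cpt R y b = 1.
Proof.
move=> l1; rewrite -(cpt_sum1 R y) (bigD1 b) //= big1 ?addr0 // => b' /eqP[].
by apply: ord_inj; case: b b' => b bl [b' b'l] /=; lia.
Qed.

Definition coupled_cpt i (y : passign G (l ^ 2) i) (z : 'I_(l ^ 2)) : rat :=
  weight (z %/ l) (cpt P (lows y : passign G l i) (low z))
    (cpt Q (lows y : passign G l i) (low z)).

Lemma coupled_cpt_ge0 i (y : passign G (l ^ 2) i) z : 0 <= coupled_cpt y z.
Proof. by apply: weight_ge0; exact: cpt_ge0. Qed.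

Lemma coupled_cpt_sum1 i (y : passign G (l ^ 2) i) : \sum_z coupled_cpt y z = 1.
Proof.
rewrite (sum_low (fun a b => weight a (cpt P (lows y : passign G l i) b)
  (cpt Q (lows y : passign G l i) b))).
rewrite -[RHS](cpt_sum1 P (lows y : passign G l i)); apply: eq_bigr => b _.
by apply: sum_weight => l1; rewrite !cpt_alphabet1.
Qed.

Definition coupled : bayes_net G (l ^ 2) :=
  BayesNet coupled_cpt_ge0 coupled_cpt_sum1.

Definition extends (k : nat) (w : nat -> nat) (x : {ffun 'I_n -> 'I_l}) :=
  [forall i : 'I_n, (i < k)%N ==> (x i == w i :> nat)].

(** [f] forces flag 0 at every node, also beyond the prefix. The prefix [w] is a raw memory row
    whose values need not be letters. *)
Definition prefix_event (f : bool) (k : nat) (w : nat -> nat) (i : 'I_n) :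
    {set 'I_(l ^ 2)} :=
  [set z : 'I_(l ^ 2) | (f ==> (z %/ l == 0)%N) && ((i < k)%N ==> (z %% l == w i)%N)].

(** Group the words over the large alphabet by their low parts. As [coupled_cpt] ignores the flags
    of the parents, the sum over flags factors over the nodes within a group: the factor is min(P_i,
    Q_i) if flag 0 is forced, and P_i otherwise. *)
Lemma inference_prefix_event f k w :
  inference coupled (prefix_event f k w) =
  \sum_(x | extends k w x) (if f then common P Q x else bn_prob P x).
Proof.
pose H (x : {ffun 'I_n -> 'I_l}) (i : 'I_n) (a : nat) :=
  if (f ==> (a == 0)%N) && ((i < k)%N ==> (x i == w i :> nat))
  then weight a (factor P i x) (factor Q i x) else 0.
have -> : inference coupled (prefix_event f k w) =
    \sum_(z : {ffun 'I_n -> 'I_(l ^ 2)}) \prod_i H (lows z) i (z i %/ l)%N.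
  rewrite /inference big_mkcond; apply: eq_bigr => z _.
  case: ifP => [/forallP zS|/negbT/forallPn[i zSi]].
    apply: eq_bigr => i _; have := zS i; rewrite inE /H ffunE => ->.
    rewrite /= /coupled_cpt /factor ffunE.
    suff -> : lows (restrict G z i) = restrict G (lows z) i by [].
    by apply/ffunP => j; rewrite !ffunE.
  rewrite (bigD1 i) //= {1}/H ffunE ifF ?mul0r //.
  by apply/negbTE; move: zSi; rewrite inE.
rewrite (partition_big (@lows n) predT) //= [RHS]big_mkcond.
apply: eq_bigr => x _.
(* The words with low part x form a product set, over which the sum of products distributes. *)
transitivity (\sum_(z in family (fun i => [pred u : 'I_(l ^ 2) | low u == x i]))
    \prod_i H x i (z i %/ l)%N).
  apply: eq_big => [z|z /eqP-> //].
  apply/eqP/familyP => [<- i|zx]; first by rewrite inE ffunE.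
  by apply/ffunP => i; rewrite ffunE; apply/eqP; exact: (zx i).
rewrite -(bigA_distr_big_dep _ (fun i (u : 'I_(l ^ 2)) => H x i (u %/ l)%N)) /=.
under eq_bigr do rewrite sum_low_eq.
case: ifP => [/forallP xw|/negbT/forallPn[i xwi]]; last first.
  by rewrite (bigD1 i) //= big1 ?mul0r // => a _; rewrite /H (negbTE xwi) andbF.
rewrite /common /bn_prob.
case: f @H => H; apply: eq_bigr => i _; rewrite /H /=; last first.
  under eq_bigr do rewrite xw.
  by apply: sum_weight => l1; rewrite /factor !cpt_alphabet1.
under eq_bigr do rewrite xw andbT.
rewrite -big_mkcond (big_pred1 (Ordinal l_gt0)) /= ?weight0 //.
Qed.

Lemma sum_excess_inference k w :
  \sum_(x | extends k w x) excess P Q x =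
  inference coupled (prefix_event false k w) -
  inference coupled (prefix_event true k w).
Proof. by rewrite !inference_prefix_event -sumrB. Qed.

End CoupledNet.

(** * Loops *)

(** Working arrays are numbered from 10 on, clear of the input, query and output arrays. [rMin] and
    [rP] share an array: the former is dead once the table is filled. *)
Local Notation vJ := 10%N.
Local Notation vE := 11%N.
Local Notation vM := 12%N.
Local Notation vI := 13%N.
Local Notation vK := 14%N.
Local Notation vD := 15%N.
Local Notation vq := 16%N.
Local Notation va := 17%N.
Local Notation vb := 18%N.
Local Notation vRow := 19%N.
Local Notation vW := 20%N.
Local Notation vLen := 22%N.
Local Notation vPos := 23%N.
Local Notation vF := 24%N.
Local Notation vCnt := 25%N.
Local Notation vSmp := 26%N.
Local Notation vIdx := 27%N.
Local Notation vPow := 28%N.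
Local Notation rX := 10%N.
Local Notation rA1 := 11%N.
Local Notation rA0 := 12%N.
Local Notation rMass := 13%N.
Local Notation rRest := 14%N.
Local Notation rMin := 15%N.
Local Notation rP := 15%N.
Local Notation rQ := 16%N.
Local Notation rAcc := 17%N.
Local Notation rZ := 18%N.

Definition nvar a := NGet a (NConst 0) (NConst 0).
Definition rvar a := RGet a (NConst 0) (NConst 0).
Definition letn a e := SetN a (NConst 0) (NConst 0) e.
Definition letr a e := SetR a (NConst 0) (NConst 0) e.

Definition for_ v e body :=
  Seq (letn v (NConst 0))
    (While (BLeN (NAdd (nvar v) (NConst 1)) e)
       (Seq body (letn v (NAdd (nvar v) (NConst 1))))).

(** Frame condition: [N] and [R] list the arrays that may have changed. *)
Definition same (N R : seq nat) (s s' : memory) : Prop :=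
  (forall a i j, a \notin N -> nmem s' a i j = nmem s a i j) /\
  (forall a i j, a \notin R -> rmem s' a i j = rmem s a i j).

Lemma same_refl N R s : same N R s s. Proof. by []. Qed.

Lemma same_trans N R N' R' s s1 s2 :
  all (mem N) N' -> all (mem R) R' ->
  same N R s s1 -> same N' R' s1 s2 -> same N R s s2.
Proof.
move=> /allP sN /allP sR [n1 r1] [n2 r2]; split=> a i j aN.
  by rewrite n2 ?n1 //; apply: contra aN => /sN.
by rewrite r2 ?r1 //; apply: contra aN => /sR.
Qed.

Lemma same_setn N R s s' a i j v :
  a \in N -> same N R s s' -> same N R s (set_nat s' a i j v).
Proof.
move=> aN [sn sr]; split=> // a' i' j' a'N; rewrite /= /upd -sn //.
by case: eqP => //= a'a; rewrite a'a aN in a'N.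
Qed.

Lemma same_setr N R s s' a i j v :
  a \in R -> same N R s s' -> same N R s (set_rat s' a i j v).
Proof.
move=> aN [sn sr]; split=> // a' i' j' a'N; rewrite /= /upd -sr //.
by case: eqP => //= a'a; rewrite a'a aN in a'N.
Qed.

Lemma upd_eq V (f : nat -> nat -> nat -> V) a i j v : upd f a i j v a i j = v.
Proof. by rewrite /upd !eqxx. Qed.

Lemma same_input n (G : dag n) l (P Q : bayes_net G l) eps del N R s s' :
  [&& arr_n \notin N, arr_l \notin N, arr_npar \notin N & arr_par \notin N] ->
  [&& arr_P \notin R, arr_Q \notin R, arr_eps \notin R & arr_del \notin R] ->
  same N R s s' -> input_mem P Q eps del s -> input_mem P Q eps del s'.
Proof.
move=> /and4P[? ? ? ?] /and4P[? ? ? ?] [sn sr] [? ? ? ? inP inQ ? ?].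
by split=> *; rewrite ?sn ?sr // => i y x; rewrite sr //;
  solve [exact: inP | exact: inQ].
Qed.

Section Loops.
Variables (n : nat) (G : dag n) (m : nat).

(** [phi] may depend on the counter, as it does through the number of trials left in [wp_estimate];
    hence the body is judged by [phi] after the increment. *)
Lemma wp_for I v e body s N K Q (J : nat -> memory -> Prop)
    (phi : I -> memory -> rat) :
  (forall k s x, J k s -> J k (set_nat s v 0 0 x)) ->
  (forall k s, J k s -> neval s e = N) ->
  (forall k s, (k < N)%N -> J k s -> nmem s v 0 0 = k ->
     wp G m body s K Q (fun s' => J k.+1 s' /\ nmem s' v 0 0 = k)
       (fun i s' => phi i (set_nat s' v 0 0 k.+1)) (phi^~ s)) ->
  J 0 s ->
  wp G m (for_ v e body) s (N * K.+2 + 2) (N * Q)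
    (fun s' => J N s' /\ nmem s' v 0 0 = N) phi
    (fun i => phi i (set_nat s v 0 0 0)).
Proof.
move=> Jv Je Jbody J0.
pose J' r s' := [/\ J (nmem s' v 0 0) s', (nmem s' v 0 0 <= N)%N &
  r = (N - nmem s' v 0 0)%N].
apply: (@wp_weaken _ _ _ _ _ _ (1 + (N * (K + 1).+1 + 1))%N (0 + N * Q)%N
  _ _ (fun s' => ~~ beval s' (BLeN (NAdd (nvar v) (NConst 1)) e) /\
       exists k', J' k' s') _ phi).
- apply: wp_setn_seq; rewrite /= -[X in wp _ _ _ _ X]/(N * (K + 1).+1 + 1)%N.
  apply: (wp_while (J := J')) => [k s' [Js' leN kE] /=|]; last first.
    by split; rewrite /= upd_eq ?subn0 //; apply: (Jv 0%N).
  rewrite (Je _ _ Js') => ltN; exists (N - (nmem s' v 0 0).+1)%N; first by lia.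
  rewrite -[Q]addn0; apply: wp_seq (Jbody _ _ _ Js' erefl) _ => [|s1]; first by lia.
  move=> [J1 s1v]; apply: wp_setn => [|i]; last by rewrite /= s1v addn1.
  by rewrite /J' /= upd_eq s1v addn1; split=> //; [apply: Jv|lia].
- by lia.
- by lia.
- move=> s' [/= + [k' [Js' leN _]]]; rewrite (Je _ _ Js') => ltN.
  have s'v : nmem s' v 0 0 = N by lia.
  by rewrite s'v in Js'.
- by [].
- by [].
Qed.

Lemma hoare_for v e body s N K Q (J : nat -> memory -> Prop) :
  (forall k s x, J k s -> J k (set_nat s v 0 0 x)) ->
  (forall k s, J k s -> neval s e = N) ->
  (forall k s, (k < N)%N -> J k s -> nmem s v 0 0 = k ->
     hoare G m body s K Q (fun s' => J k.+1 s' /\ nmem s' v 0 0 = k)) ->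
  J 0 s ->
  hoare G m (for_ v e body) s (N * K.+2 + 2) (N * Q) (J N).
Proof.
move=> Jv Je Jbody J0; apply: (hoare_weaken (wp_for Jv Je Jbody J0)) => //.
by move=> s' [].
Qed.

End Loops.

Definition for3 e body :=
  for_ vq e (for_ va (nvar arr_l) (for_ vb (nvar arr_l) body)).

(** The flattened counter (q l + a) l + b = q l^2 + (a l + b) stands for row q and the letter with
    flag a and low part b; indexing the invariant by it turns the three loops into a single
    sweep. *)
Lemma hoare_for3 n (G : dag n) m e body s D l K (J : nat -> memory -> Prop) :
  (forall N s v x, v \in [:: vq; va; vb] -> J N s -> J N (set_nat s v 0 0 x)) ->
  (forall N s, J N s -> neval s e = D) ->
  (forall N s, J N s -> nmem s arr_l 0 0 = l) ->
  (forall q a b s, (q < D)%N -> (a < l)%N -> (b < l)%N ->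
     J ((q * l + a) * l + b)%N s ->
     nmem s vq 0 0 = q -> nmem s va 0 0 = a -> nmem s vb 0 0 = b ->
     hoare G m body s K 0 (fun s' => [/\ J ((q * l + a) * l + b).+1 s',
       nmem s' vq 0 0 = q, nmem s' va 0 0 = a & nmem s' vb 0 0 = b])) ->
  J 0 s ->
  hoare G m (for3 e body) s (D * (l * (l * K.+2 + 2).+2 + 2).+2 + 2) 0
    (J (D * l * l)%N).
Proof.
move=> Jset Je Jl Jbody J0.
pose Jq q s := J (q * l * l)%N s.
apply: (@hoare_weaken _ _ _ _ _ _ (D * 0) _ _ (Jq D));
  [|exact: leqnn|by rewrite muln0|by []].
apply: hoare_for => // [q s' x|k|q s' qD Jqs' s'q]; rewrite /Jq.
- exact: Jset.
- exact: Je.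
pose Ja a s := J ((q * l + a) * l)%N s /\ nmem s vq 0 0 = q.
apply: (@hoare_weaken _ _ _ _ _ _ (l * 0) _ _ (Ja l));
  [|exact: leqnn|by rewrite muln0|]; last first.
  by move=> s'' []; rewrite -mulSnr.
apply: hoare_for => [a s1 x [? ?]|a s1 [/Jl //]|a s1 al [Ja1 s1q] s1a|].
- by split=> //; apply: Jset.
- pose Jb b s := [/\ J ((q * l + a) * l + b)%N s, nmem s vq 0 0 = q &
    nmem s va 0 0 = a].
  apply: (@hoare_weaken _ _ _ _ _ _ (l * 0) _ _ (Jb l));
    [|exact: leqnn|by rewrite muln0|]; last first.
    by move=> s'' []; rewrite /Ja -mulSnr addnS.
    apply: hoare_for => [b s2 x [? ? ?]|b s2 [/Jl //]|b s2 bl [Jb2 ? ?] s2b|].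
  + by split=> //; apply: Jset.
  + apply: hoare_weaken (Jbody _ _ _ _ qD al bl Jb2 _ _ _) _ _ _ => // s3 [? ? ? ?].
    by rewrite /Jb addnS.
  + by split; rewrite ?addn0.
- by split; rewrite ?addn0.
Qed.

(** * The algorithm *)

Definition sqrl := NMul (nvar arr_l) (nvar arr_l).
Definition flag_letter := NAdd (NMul (nvar va) (nvar arr_l)) (nvar vb).
Definition cell := NAdd (NMul (nvar vq) sqrl) flag_letter.
Definition entry a := RGet a (nvar vI) (NGet vRow cell (NConst 0)).

Definition fill_cell :=
  Seq (SetN vRow cell (NConst 0)
         (NAdd (NMul (NGet vRow (nvar vq) (NConst 0)) (nvar arr_l)) (nvar vb)))
  (Seq (If (BLeR (entry arr_P) (entry arr_Q))
          (letr rMin (entry arr_P)) (letr rMin (entry arr_Q)))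
       (SetR arr_qnet (nvar vI) cell
          (RAdd (RMul (ROfNat (NSub (NConst 1) (nvar va))) (rvar rMin))
             (RMul (ROfNat (NMul (nvar va) (NSub (NConst 2) (nvar va))))
                (RSub (entry arr_P) (rvar rMin)))))).

(* Array vRow maps the row index of an assignment over the alphabet of size   *)
(* l ^ 2 to the row index of its letters.  One more digit turns row q into    *)
(* the rows q * l ^ 2 + z, so the array is filled in increasing order, and    *)
(* the same recursion gives the positions of the entries of P and Q.          *)
Definition fill_table :=
  for_ vI (nvar arr_n)
    (Seq (letn vD (NConst 1))
    (Seq (for_ vK (NGet arr_npar (nvar vI) (NConst 0))
            (letn vD (NMul (nvar vD) sqrl)))
    (Seq (SetN vRow (NConst 0) (NConst 0) (NConst 0))
         (for3 (nvar vD) fill_cell)))).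

(** * Row indices as numerals in base l^2 *)

Lemma digit_uniq M y R q x : (y < M)%N -> (x < M)%N ->
  (y + M * R = q * M + x)%N -> y = x /\ R = q.
Proof.
move=> yM xM yRqx; have M_gt0 : (0 < M)%N by lia.
have yx : y = x.
  have := congr1 (modn^~ M) yRqx.
  by rewrite modnMDl addnC mulnC modnMDl !modn_small.
split=> //; apply/eqP; rewrite -(eqn_pmul2l M_gt0); apply/eqP; lia.
Qed.

Section RowIndex.
Variable l : nat.
Hypothesis l_gt0 : (0 < l)%N.

Lemma row_index_recl d m (y : {ffun 'I_d.+1 -> 'I_m}) :
  row_index y = (y ord0 + m * row_index [ffun k => y (lift ord0 k)])%N.
Proof.
rewrite /row_index big_ord_recl expn0 muln1 big_distrr /=; congr (_ + _)%N.
by apply: eq_bigr => k _; rewrite ffunE /bump /= add1n expnS mulnCA.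
Qed.

Lemma row_index_lt d m (y : {ffun 'I_d -> 'I_m}) : (row_index y < m ^ d)%N.
Proof.
elim: d y => [|d IHd] y; first by rewrite /row_index big_ord0.
rewrite row_index_recl expnS; have := IHd [ffun k => y (lift ord0 k)].
rewrite -(leq_pmul2l (leq_ltn_trans (leq0n _) (ltn_ord (y ord0)))) mulnS.
by apply: leq_trans; rewrite ltn_add2r.
Qed.

Lemma row_index0 d (y : {ffun 'I_d -> 'I_(l ^ 2)}) :
  row_index y = 0%N -> row_index (lows l_gt0 y) = 0%N.
Proof.
elim: d y => [|d IHd] y; first by rewrite /row_index !big_ord0.
rewrite !row_index_recl ffunE /= => /eqP.
rewrite addn_eq0 muln_eq0 expn_eq0 eqn0Ngt [l == _]eqn0Ngt l_gt0 /=.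
rewrite -eqn0Ngt => /andP[/eqP-> /eqP tail0]; rewrite mod0n add0n.
apply/eqP; rewrite muln_eq0; apply/orP; right; apply/eqP.
transitivity (row_index (lows l_gt0 [ffun k => y (lift ord0 k)])).
  by congr row_index; apply/ffunP => k; rewrite !ffunE.
exact: IHd.
Qed.

(** The length d is quantified inside because the recursion drops the first digit of y. *)
Definition rows_ok N (s : memory) := forall d (y : {ffun 'I_d -> 'I_(l ^ 2)}),
  (row_index y < N)%N -> nmem s vRow (row_index y) 0 = row_index (lows l_gt0 y).

(** A positive row index q is below q l^2 <= N if l > 1, and cannot occur if l = 1. Row 0 is known
    from its explicit initialisation, since [rows_ok] says nothing at N = 0. *)
Lemma rows_okE N d (y : {ffun 'I_d -> 'I_(l ^ 2)}) (s : memory) :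
  rows_ok N s -> nmem s vRow 0 0 = 0%N -> (row_index y * l ^ 2 <= N)%N ->
  nmem s vRow (row_index y) 0 = row_index (lows l_gt0 y).
Proof.
move=> ok row0 yN; have [y0|y_gt0] := posnP (row_index y).
  by rewrite y0 row0 row_index0.
apply: ok; apply: leq_trans yN; have [l1|l_gt1] := leqP l 1; last by nia.
have ld1 : ((l ^ 2) ^ d = 1)%N by rewrite (anti_leq (_ : l <= 1 <= l)%N) ?l1 ?exp1n.
by have := row_index_lt y; rewrite ld1; lia.
Qed.

(** In base l^2, N has first digit a l + b, of low part b, followed by the digits of q; its image is
    thus b + l r. *)
Lemma rows_ok_step q a b r (s : memory) :
  (a < l)%N -> (b < l)%N -> let N := ((q * l + a) * l + b)%N in
  rows_ok N s -> nmem s vRow 0 0 = 0%N -> nmem s vRow q 0 = r ->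
  rows_ok N.+1 (set_nat s vRow N 0 (r * l + b)).
Proof.
move=> al bl N ok row0 rowq d y; rewrite ltnS leq_eqVlt => /orP[/eqP yN|yN].
  rewrite yN /= upd_eq; case: d y yN => [|d] y yN.
    by move: yN; rewrite /row_index !big_ord0 /N -rowq; case: q {ok N rowq} => [|q];
      rewrite ?row0; nia.
  move: yN; rewrite !row_index_recl ffunE /=.
  set R := row_index _; set R' := row_index _ => yN.
  have [-> Rq] : (y ord0 = a * l + b :> nat)%N /\ R = q.
    apply: (@digit_uniq (l ^ 2)) => //; first by nia.
    by rewrite yN /N -mulnn; lia.
  have -> : R' = r.
    rewrite -rowq -Rq (rows_okE ok row0); last by rewrite -/R Rq /N; nia.
    by congr row_index; apply/ffunP => k; rewrite !ffunE.
  by rewrite modnMDl modn_small //; lia.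
by rewrite /= /upd /= ltn_eqF // ok.
Qed.

End RowIndex.

(** * Writing the table of the coupled net *)

Section FillTable.
Variables (n : nat) (G : dag n) (l : nat) (P Q : bayes_net G l) (eps del : rat).
Hypothesis l_gt0 : (0 < l)%N.
Local Notation input := (input_mem P Q eps del).
Local Notation hoare := (hoare G (l ^ 2)).
Local Notation B := (coupled P Q l_gt0).

Lemma hoare_fill_cell s i q a b :
  nmem s arr_l 0 0 = l ->
  nmem s vI 0 0 = i -> nmem s vq 0 0 = q -> nmem s va 0 0 = a ->
  nmem s vb 0 0 = b ->
  let N := ((q * l + a) * l + b)%N in
  let r := (nmem s vRow q 0 * l + b)%N in
  let p1 := rmem s arr_P i r in let p2 := rmem s arr_Q i r in
  hoare fill_cell s 4 0 (eq (set_rat (set_rat (set_nat s vRow N 0 r)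
    rMin 0 0 (Num.min p1 p2)) arr_qnet i N (weight a p1 p2))).
Proof.
move=> sl si sq sa sb N r p1 p2.
have cellE : (q * (l * l) + (a * l + b))%N = N by rewrite /N; lia.
set s1 := set_nat s vRow N 0 r.
apply: wp_setn_seq; rewrite [neval _ _]/= sq sa sb sl cellE /= sq sb sl -/r -/s1.
apply: (@hoare_seq _ _ _ _ _ _ _ 2 0 1 0
  (eq (set_rat s1 rMin 0 0 (Num.min p1 p2)))).
  have e1 : reval s1 (entry arr_P) = p1.
    by rewrite /= /upd /= si sq sa sb sl cellE eqxx.
  have e2 : reval s1 (entry arr_Q) = p2.
    by rewrite /= /upd /= si sq sa sb sl cellE eqxx.
  apply: wp_if.
    rewrite -[beval _ _]/(reval s1 (entry arr_P) <= reval s1 (entry arr_Q)).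
    by rewrite e1 e2 => p12; apply: wp_setr; rewrite ?e1 ?min_l.
  rewrite -[beval _ _]/(reval s1 (entry arr_P) <= reval s1 (entry arr_Q)).
  rewrite e1 e2 -ltNge => /ltW p12.
  by apply: wp_setr; rewrite ?e2 ?min_r.
move=> _ <-; apply: wp_setr => //.
by rewrite /= /upd /= si sq sa sb sl cellE eqxx.
Qed.

Lemma hoare_fill_row (i : 'I_n) s :
  input s -> nmem s vI 0 0 = i ->
  nmem s vD 0 0 = ((l ^ 2) ^ #|parents G i|)%N -> nmem s vRow 0 0 = 0%N ->
  hoare (for3 (nvar vD) fill_cell) s
    ((l ^ 2) ^ #|parents G i| * (l * (l * 6 + 2).+2 + 2).+2 + 2) 0
    (fun s' => [/\ same [:: vq; va; vb; vRow] [:: rMin; arr_qnet] s s',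
      forall (y : passign G (l ^ 2) i) (x : 'I_(l ^ 2)),
        rmem s' arr_qnet i (row_index y * l ^ 2 + x) = cpt B y x &
      forall i' j : nat, i' != i :> nat -> rmem s' arr_qnet i' j = rmem s arr_qnet i' j]).
Proof.
move=> inp si sD row0; set D := ((l ^ 2) ^ _)%N in sD *.
pose J N s' := [/\ same [:: vq; va; vb; vRow] [:: rMin; arr_qnet] s s',
  rows_ok l_gt0 N s' /\ nmem s' vRow 0 0 = 0%N,
  forall (y : passign G (l ^ 2) i) (x : 'I_(l ^ 2)), (row_index y * l ^ 2 + x < N)%N ->
    rmem s' arr_qnet i (row_index y * l ^ 2 + x) = cpt B y x &
  forall i' j : nat, i' != i :> nat -> rmem s' arr_qnet i' j = rmem s arr_qnet i' j].
have inpJ N s' : J N s' -> input s'.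
  by case=> sm _ _ _; apply: same_input sm inp.
suff: hoare (for3 (nvar vD) fill_cell) s (D * (l * (l * 6 + 2).+2 + 2).+2 + 2) 0
    (J (D * l * l)%N).
  move=> /hoare_weaken; apply=> // s' [sm _ net rows]; split=> // y x.
  by apply: net; have := row_index_lt y; rewrite -/D; have := ltn_ord x; nia.
apply: hoare_for3.
- move=> N s' v x; rewrite !inE => vin [sm [ok row] net rows].
  have smv : same [:: vq; va; vb; vRow] [:: rMin; arr_qnet] s (set_nat s' v 0 0 x).
    by apply: same_setn sm; rewrite !inE; case/or3P: vin => ->; rewrite ?orbT.
  have rowv r : nmem (set_nat s' v 0 0 x) vRow r 0 = nmem s' vRow r 0.
    by rewrite /= /upd; case/or3P: vin => /eqP->.
  by split=> //; split=> [d y|]; rewrite rowv //; exact: ok.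
- by move=> N s' [[sn _] _ _ _]; rewrite /= sn.
- by move=> N s' /inpJ[].
- move=> q a b s' qD al bl [sm [ok row] net rows] s'q s'a s'b.
  set N := ((q * l + a) * l + b)%N in ok net *.
  have [sn sr] := sm.
  have inps' : input s' by apply: same_input sm inp.
  apply: hoare_weaken (hoare_fill_cell (i := i) (input_l inps') _ s'q s'a s'b)
    _ _ _ => //; first by rewrite sn.
  move=> _ <-; split; rewrite //= /upd ?s'q ?s'a ?s'b //=; split.
  + by do 2 apply: same_setr => //; apply: same_setn.
  + split; first by exact: rows_ok_step.
    (* Cell 0 is written only at N = 0, and receives 0 again. *)
    rewrite /= /upd eqxx andbT /=; case: eqP => // N0.
    have -> : q = 0%N by rewrite /N in N0; nia.
    by rewrite row; rewrite /N in N0; nia.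
  + move=> y x; rewrite ltnS leq_eqVlt /= /upd /= => /orP[/eqP yxN|yxN].
      rewrite yxN !eqxx /=.
      have [xE yq] : (x = a * l + b :> nat)%N /\ row_index y = q.
        apply: (@digit_uniq (l ^ 2)) => //; first by nia.
        by rewrite mulnC addnC yxN /N -mulnn; lia.
      have -> : (nmem s' vRow q 0 * l + b)%N =
          (row_index (lows l_gt0 y : passign G l i) * l + low l_gt0 x)%N.
        rewrite -yq (rows_okE ok row) ?yq; last by rewrite /N -mulnn; lia.
        by rewrite /= xE modnMDl modn_small.
      rewrite (input_P inps') (input_Q inps') /= /coupled_cpt.
      by rewrite xE divnMDl // divn_small // addn0.
    by rewrite eqxx /= ltn_eqF //; exact: net.
  + by move=> i' j i'i; rewrite /= /upd /= (negPf i'i); exact: rows.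
- by [].
Qed.

Lemma hoare_fill_table s K0 :
  input s ->
  (forall i, (l ^ 2) ^ #|parents G i| * (l * (l * 6 + 2).+2 + 2).+2 + 2 <= K0)%N ->
  hoare fill_table s (n * (K0 + n * 3 + 6) + 2) 0 (fun s' =>
    same [:: vI; vK; vD; vq; va; vb; vRow] [:: rMin; arr_qnet] s s' /\
    net_mem arr_qnet B s').
Proof.
move=> inp leK0.
pose J k s' := same [:: vI; vK; vD; vq; va; vb; vRow] [:: rMin; arr_qnet] s s' /\
  forall (i : 'I_n) (y : passign G (l ^ 2) i) (x : 'I_(l ^ 2)), (i < k)%N ->
    rmem s' arr_qnet i (row_index y * l ^ 2 + x) = cpt B y x.
have inpJ k s' : J k s' -> input s' by case=> sm _; apply: same_input sm inp.
apply: (@hoare_weaken _ _ _ _ _ (n * (K0 + n * 3 + 4).+2 + 2) (n * 0)%N _ _ (J n)).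
- apply: (hoare_for (J := J)) => [k s' x [sm net]|k s' /inpJ[]//|k s' kn|].
  + by split=> //; apply: same_setn.
  + move=> Js' s'I; have inps' := inpJ _ _ Js'.
    pose i := Ordinal kn; set d := #|parents G i|.
    pose Jd r s1 := same [:: vK; vD] [::] s' s1 /\ nmem s1 vD 0 0 = ((l ^ 2) ^ r)%N.
    have dn : (d <= n)%N by rewrite -[X in (_ <= X)%N]card_ord max_card.
    apply: (@hoare_weaken _ _ _ _ _ (1 + (d * 3 + 2 + (1 +
      ((l ^ 2) ^ d * (l * (l * 6 + 2).+2 + 2).+2 + 2)))) (d * 0 + 0) _ _
      (fun s1 => J k.+1 s1 /\ nmem s1 vI 0 0 = k));
      [|by have := leK0 i; rewrite -/d; lia|by rewrite muln0|by []].
    apply: wp_setn_seq.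
    apply: hoare_seq (hoare_for (J := Jd) _ _ _ _) _.
    * by move=> r s1 x [sm sD]; split; [exact: same_setn|].
    * move=> r s1 [[sn _] _]; rewrite /= !sn //= /upd /= s'I.
      exact: (input_npar inps' i).
    * move=> r s1 rd [sm sD] s1K; apply: wp_setn => //.
      have inps1 : input s1 by apply: same_input sm inps'.
      split; last by rewrite /= /upd /=.
      split; first exact: same_setn.
      by rewrite /= upd_eq sD (input_l inps1) mulnn [RHS]expnSr.
    * by split; [exact: same_setn|].
    move=> s1 [sm1 s1D]; apply: wp_setn_seq.
    have inps1 : input s1 by apply: same_input sm1 inps'.
    apply: hoare_weaken (hoare_fill_row (i := i) _ _ _ _) _ _ _ => //.
    * by apply: same_input inps1; [| |exact: same_setn (same_refl [:: vRow] [::] _)].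
    * by have [sn _] := sm1; rewrite /= /upd /= sn.
    * move=> s2 [sm2 net rows]; have [sn1 sr1] := sm1; have [sn2 _] := sm2.
      have [sms' nets'] := Js'.
      have sm' : same [:: vK; vD; vq; va; vb; vRow] [:: rMin; arr_qnet] s' s2.
        apply: same_trans sm2 => //.
        apply: same_setn => //; apply: same_trans sm1 => //.
      split; last by have [-> //] := sm'.
      split; first by apply: same_trans sm' => //.
      move=> j y x; rewrite ltnS leq_eqVlt => /orP[/eqP ji|jk].
        have ij : j = i by exact: val_inj.
        by move: y; rewrite ij => y; exact: net.
      by rewrite rows ?ltn_eqF //= sr1 // nets'.
  + by split=> //; apply: same_setn.
- by lia.
- by rewrite muln0.
- by move=> s' [sm net]; split=> // i y x; exact: net.
Qed.

End FillTable.

(** * Excess of a prefix by two inference queries *)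

Definition selected (f : bool) :=
  let w := NGet vW (nvar vq) (NConst 0) in
  (* In truncated arithmetic, the first summand is nonzero exactly beyond the prefix, and the
     second, 1 - |b - w|, exactly when the low part b is the prescribed letter w. *)
  let e := NAdd (NSub (NAdd (nvar vq) (NConst 1)) (nvar vLen))
    (NSub (NConst 1) (NAdd (NSub (nvar vb) w) (NSub w (nvar vb)))) in
  if f then NMul e (NSub (NConst 1) (nvar va)) else e.

Definition set_query f :=
  for3 (nvar arr_n) (SetN arr_qset (nvar vq) flag_letter (selected f)).

Definition prefix_mass :=
  Seq (set_query false) (Seq (Query rA1 (NConst 0) (NConst 0))
  (Seq (set_query true) (Seq (Query rA0 (NConst 0) (NConst 0))
    (letr rMass (RSub (rvar rA1) (rvar rA0)))))).

Definition wval (s : memory) (i : nat) := nmem s vW i 0.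

Section PrefixMass.
Variables (n : nat) (G : dag n) (l : nat) (P Q : bayes_net G l) (eps del : rat).
Hypothesis l_gt0 : (0 < l)%N.
Local Notation input := (input_mem P Q eps del).
Local Notation hoare := (hoare G (l ^ 2)).
Local Notation B := (coupled P Q l_gt0).

Lemma hoare_set_query f s :
  input s -> net_mem arr_qnet B s ->
  hoare (set_query f) s (n * (l * (l * 3 + 2).+2 + 2).+2 + 2) 0 (fun s' =>
    same [:: vq; va; vb; arr_qset] [::] s s' /\
    query_mem B (@prefix_event n l f (nmem s vLen 0 0) (wval s)) s').
Proof.
move=> inp net; set S := @prefix_event n l _ _ _.
pose J N s' := same [:: vq; va; vb; arr_qset] [::] s s' /\
  forall (i : 'I_n) (x : 'I_(l ^ 2)), (i * l ^ 2 + x < N)%N ->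
    (x \in S i) = (nmem s' arr_qset i x != 0%N).
suff: hoare (set_query f) s (n * (l * (l * 3 + 2).+2 + 2).+2 + 2) 0
    (J (n * l * l)%N).
  move=> /hoare_weaken; apply=> // s' [sm sel]; split=> //; split.
    by move=> i y x; have [_ ->] := sm.
  by move=> i x; apply: sel; have := ltn_ord i; have := ltn_ord x; nia.
have inpJ N s' : J N s' -> input s' by case=> sm _; apply: same_input sm inp.
apply: hoare_for3.
- move=> N s' v x; rewrite !inE => vin [sm sel]; split.
    by apply: same_setn sm; rewrite !inE; case/or3P: vin => ->; rewrite ?orbT.
  by move=> i y /sel->; rewrite /= /upd; case/or3P: vin => /eqP->.
- by move=> N s' /inpJ[].
- by move=> N s' /inpJ[].
- move=> q a b s' qn al bl Js' s'q s'a s'b; have inps' := inpJ _ _ Js'.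
  have [[sn sr] sel] := Js'; set N := ((q * l + a) * l + b)%N in sel Js' *.
  have cellE : neval s' flag_letter = (a * l + b)%N.
    by rewrite /= s'a s'b (input_l inps').
  apply: wp_setn; rewrite // cellE; split; rewrite ?s'q ?s'a ?s'b //.
  split=> [|i x]; first by apply: same_setn => //; split.
  rewrite ltnS leq_eqVlt => /orP[/eqP ixN|ixN].
    have [xE iq] : (x = a * l + b :> nat)%N /\ i = q :> nat.
      apply: (@digit_uniq (l ^ 2)) => //; first by nia.
      by rewrite mulnC addnC ixN /N -mulnn; lia.
    rewrite /= xE s'q iq upd_eq inE xE iq.
    rewrite divnMDl // divn_small // addn0 modnMDl modn_small //.
    have s'len : nmem s' vLen 0 0 = nmem s vLen 0 0 by rewrite sn.
    have s'w : nmem s' vW q 0 = wval s q by rewrite sn.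
    have eE : ((q < nmem s vLen 0 0)%N ==> (b == wval s q)) =
        (q + 1 - nmem s vLen 0 0 + (1 - (b - wval s q + (wval s q - b))) != 0)%N.
      by apply/idP/idP; lia.
    rewrite /selected; case: (f); rewrite /= s'q s'b s'len s'w ?s'a eE //.
    by apply/idP/idP; nia.
  have -> : nmem (set_nat s' arr_qset (neval s' (nvar vq)) (a * l + b)
      (neval s' (selected f))) arr_qset i x = nmem s' arr_qset i x.
    rewrite /= /upd /= s'q ifF //; apply/negP => /andP[/eqP iq /eqP xE].
    by move: ixN; rewrite iq xE /N -mulnn; lia.
  exact: sel.
- by [].
Qed.

Lemma hoare_prefix_mass s :
  input s -> net_mem arr_qnet B s ->
  hoare prefix_mass s (n * (l * (l * 3 + 2).+2 + 2).+2 * 2 + 5) 2 (fun s' =>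
    same [:: vq; va; vb; arr_qset] [:: rA1; rA0; rMass] s s' /\
    rmem s' rMass 0 0 =
      \sum_(x | extends (nmem s vLen 0 0) (wval s) x) excess P Q x).
Proof.
move=> inp net; pose Kq := (n * (l * (l * 3 + 2).+2 + 2).+2)%N.
apply: (@hoare_weaken _ _ _ _ _ ((Kq + 2) + (0 + ((Kq + 2) + (0 + 1))))
  (0 + (1 + (0 + (1 + 0))))); [|by rewrite /Kq; lia|by []|by move=> s'; exact].
apply: hoare_seq (hoare_set_query _ inp net) _ => s1 [sm1 q1].
apply: hoare_seq (hoare_query _ _ _ q1) _ => _ <-; set s2 := set_rat _ _ _ _ _.
have sm2 : same [:: vq; va; vb; arr_qset] [:: rA1; rA0; rMass] s s2.
  by apply: same_setr => //; apply: same_trans sm1.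
have inp2 : input s2 by apply: same_input sm2 inp.
have net2 : net_mem arr_qnet B s2 by move=> i y x; have [_ ->] := sm2.
apply: hoare_seq (hoare_set_query _ inp2 net2) _ => s3 [sm3 q3].
apply: hoare_seq (hoare_query _ _ _ q3) _ => _ <-.
apply: wp_setr => //; split.
  apply: same_setr => //; apply: same_setr => //.
  exact: same_trans sm3.
have [sn2 _] := sm2; have [sn3 sr3] := sm3.
rewrite /= /upd /= sr3 //= /upd /= sum_excess_inference sn2 //.
congr (_ - inference _ _); rewrite /prefix_event /wval.
by apply: funext => i; apply/setP => z; rewrite !inE sn2.
Qed.

End PrefixMass.

(** * Drawing a word letter by letter *)

Definition accept_letter :=
  Seq (letr rRest (rvar rMass))
  (Seq (letn vPos (NAdd (nvar vPos) (NConst 1)))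
     (SetN vW (nvar vPos) (NConst 0) (NConst 0))).

Definition reject_letter :=
  Seq (letr rRest (RSub (rvar rRest) (rvar rMass)))
    (SetN vW (nvar vPos) (NConst 0)
       (NAdd (NGet vW (nvar vPos) (NConst 0)) (NConst 1))).

Definition walk_step :=
  Seq (letn vLen (NAdd (nvar vPos) (NConst 1)))
  (Seq prefix_mass
  (Seq (Flip vF (NConst 0) (NConst 0) (RDiv (rvar rMass) (rvar rRest)))
     (If (BLeN (NConst 1) (nvar vF)) accept_letter reject_letter))).

(* Samples x with probability excess x / Z.  In the loop, rRest is the total  *)
(* excess of the words x that agree with vW below node vPos, and whose letter *)
(* at that node is at least the one in vW.                                    *)
Definition sample_word :=
  Seq (letn vPos (NConst 0))
  (Seq (SetN vW (NConst 0) (NConst 0) (NConst 0))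
  (Seq (letr rRest (rvar rZ))
     (While (BLeN (NAdd (nvar vPos) (NConst 1)) (nvar arr_n)) walk_step))).

Section Sampler.
Variables (n : nat) (G : dag n) (l : nat) (P Q : bayes_net G l) (eps del : rat).
Hypothesis l_gt0 : (0 < l)%N.
Local Notation input := (input_mem P Q eps del).
Local Notation B := (coupled P Q l_gt0).
Implicit Types (x : {ffun 'I_n -> 'I_l}) (w : nat -> nat).
Implicit Types (F : {ffun 'I_n -> 'I_l} -> rat).

(** The words still possible in the walk: letters below node k are settled, and at k those smaller
    than w k have been rejected. *)
Definition candidate (k : nat) w x :=
  extends k w x && [forall i : 'I_n, (i == k :> nat) ==> (w i <= x i)%N].

Lemma candidate_split k w w' F :
  (k < n)%N -> (forall i, w' i = if i == k then (w k).+1 else w i) ->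
  \sum_(x | candidate k w x) F x =
  \sum_(x | extends k.+1 w x) F x + \sum_(x | candidate k w' x) F x.
Proof.
move=> kn w'E; rewrite (bigID (fun x => x (Ordinal kn) == w k :> nat)) /=.
congr (_ + _); apply: eq_bigl => x; apply/andP/idP.
- move=> [/andP[/forallP xw _] /eqP xk]; apply/forallP => i; apply/implyP.
  rewrite ltnS leq_eqVlt => /orP[/eqP ik|/(implyP (xw i)) //].
  by rewrite ik -xk; apply/eqP; congr (nat_of_ord (x _)); exact: val_inj.
- move=> /forallP xw; have xk : x (Ordinal kn) == w k :> nat.
    by apply: (implyP (xw (Ordinal kn))) => /=.
  split=> //; apply/andP; split; apply/forallP => i; apply/implyP.
    by move=> ik; apply: (implyP (xw i)); exact: ltnW.
  move=> /eqP ik; rewrite ik -(eqP xk) leq_eqVlt; apply/orP; left.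
  by apply/eqP; congr (nat_of_ord (x _)); exact: val_inj.
- move=> [/andP[/forallP xw /forallP xk] xkn]; apply/andP.
  split; apply/forallP => i; apply/implyP.
    by move=> ik; rewrite w'E (ltn_eqF ik); exact: (implyP (xw i) ik).
  move=> /eqP ik; rewrite w'E ik eqxx ltn_neqAle eq_sym.
  have -> : i = Ordinal kn by exact: val_inj.
  by rewrite xkn /=; exact: (implyP (xk (Ordinal kn))).
- move=> /andP[/forallP xw /forallP xk].
  have := implyP (xk (Ordinal kn)) (eqxx _); rewrite w'E eqxx => wx.
  split; last by rewrite gtn_eqF.
  apply/andP; split; apply/forallP => i; apply/implyP => ik.
    by have := implyP (xw i) ik; rewrite w'E (ltn_eqF ik).
  have -> : i = Ordinal kn by apply: val_inj; exact/eqP.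
  exact: ltnW.
Qed.

Lemma candidateS k w w' F :
  (forall i, w' i = if i == k.+1 then 0%N else w i) ->
  \sum_(x | candidate k.+1 w' x) F x = \sum_(x | extends k.+1 w x) F x.
Proof.
move=> w'E; apply: eq_bigl => x; rewrite /candidate.
have -> : extends k.+1 w' x = extends k.+1 w x.
  by apply: eq_forallb => i; case: ltnP => //= ik; rewrite w'E (ltn_eqF ik).
rewrite andb_idr // => _; apply/forallP => i; apply/implyP => ik.
by rewrite w'E ik.
Qed.

Lemma candidate0 w F :
  w 0%N = 0%N -> \sum_(x | candidate 0 w x) F x = \sum_x F x.
Proof.
move=> w0; apply: eq_bigl => x; apply/andP; split; apply/forallP => i //.
by apply/implyP => /eqP->; rewrite w0.
Qed.

Lemma sum_excess0 (p : pred {ffun 'I_n -> 'I_l}) F :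
  \sum_(x | p x) excess P Q x = 0 -> \sum_(x | p x) excess P Q x * F x = 0.
Proof.
move=> /psumr_eq0P e0; apply: big1 => x px.
by rewrite e0 ?mul0r // => y _; exact: excess_ge0.
Qed.

Lemma sum_excess_ge0 (p : pred {ffun 'I_n -> 'I_l}) :
  0 <= \sum_(x | p x) excess P Q x.
Proof. by apply: sumr_ge0 => x _; exact: excess_ge0. Qed.

Definition word (s : memory) : {ffun 'I_n -> 'I_l} :=
  [ffun i : 'I_n => insubd (Ordinal l_gt0) (wval s i)].

Local Notation NS := [:: vq; va; vb; arr_qset; vLen; vPos; vF; vW].
Local Notation RS := [:: rA1; rA0; rMass; rRest].
Local Notation Kq := (n * (l * (l * 3 + 2).+2 + 2).+2 * 2 + 5)%N.

Local Notation pos s := (nmem s vPos 0 0).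
Local Notation rest s := (rmem s rRest 0 0).

Definition rest_ok s := [/\ (pos s <= n)%N, 0 < rest s &
  rest s = \sum_(x | candidate (pos s) (wval s) x) excess P Q x].

(** Conditional mean of psi i at the final word, given the state of the walk. *)
Definition walk_mean I (psi : I -> {ffun 'I_n -> 'I_l} -> rat) i s :=
  (\sum_(x | candidate (pos s) (wval s) x) excess P Q x * psi i x) / rest s.

(** Positive remaining mass provides a candidate, whose letter bounds the current one: the walk
    never runs past the last letter. *)
Lemma rest_ok_lt s : rest_ok s -> (pos s < n)%N -> (wval s (pos s) < l)%N.
Proof.
move=> [_ R_gt0 RE] pn.
have [x /andP[_ /forallP xw]|no_x] := pickP (candidate (pos s) (wval s)).
  apply: leq_ltn_trans (ltn_ord (x (Ordinal pn))).
  exact: (implyP (xw (Ordinal pn))).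
by move: R_gt0; rewrite RE big_pred0 ?ltxx.
Qed.

(** The remaining mass is M + C, with M for accepting the letter and C for rejecting it, and
    [candidate_split] splits the numerator of the mean accordingly. The measure decreases: a
    rejection increases the letter, and an acceptance trades a letter below l for letter 0 at the
    next node. *)
Lemma wp_walk_step I (psi : I -> {ffun 'I_n -> 'I_l} -> rat) s :
  input s -> net_mem arr_qnet B s -> rest_ok s -> (pos s < n)%N ->
  wp G (l ^ 2) walk_step s (Kq + 6) 2 (fun s' => [/\ same NS RS s s', rest_ok s' &
      ((n - pos s') * l - wval s' (pos s') < (n - pos s) * l - wval s (pos s))%N])
    (walk_mean psi) (walk_mean psi ^~ s).
Proof.
move=> inp net ok pn; have wl := rest_ok_lt ok pn; have [_ R_gt0 RE] := ok.
rewrite (_ : Kq + 6 = (Kq + 5).+1)%N; last by lia.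
apply: wp_setn_seq; set s1 := set_nat _ _ _ _ _.
have sm1 : same NS RS s s1 by exact: same_setn.
apply: (@hoare_seq _ _ _ _ _ _ _ _ 2 5 0);
  first by apply: (@hoare_prefix_mass _ _ _ P Q eps del l_gt0) => //;
    exact: same_input sm1 inp.
move=> s2 [sm12 massE].
have [sn2 sr2] : same NS RS s s2 by apply: same_trans sm12.
have [sn12 sr12] := sm12.
have wE2 i : wval s2 i = wval s i by rewrite /wval sn12.
have pos2 : pos s2 = pos s by rewrite sn12.
have rest2 : rest s2 = rest s by rewrite sr12.
set M := \sum_(x | _) _ in massE.
have {M massE} massE : rmem s2 rMass 0 0 =
    \sum_(x | extends (pos s).+1 (wval s) x) excess P Q x.
  by rewrite massE /M /= addn1.
set M := \sum_(x | _) _ in massE.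
pose w' i := if i == pos s then (wval s (pos s)).+1 else wval s i.
have RMC := candidate_split (w' := w') (excess P Q) pn (fun=> erefl).
rewrite -RE -/M in RMC; set C := \sum_(x | _) _ in RMC.
have M_ge0 : 0 <= M by exact: sum_excess_ge0.
have C_ge0 : 0 <= C by exact: sum_excess_ge0.
have split_mean i := candidate_split (w' := w') (fun x => excess P Q x * psi i x)
  pn (fun=> erefl).
pose v1 i := (\sum_(x | extends (pos s).+1 (wval s) x) excess P Q x * psi i x) / M.
pose v0 i := (\sum_(x | candidate (pos s) w' x) excess P Q x * psi i x) / C.
have rE : reval s2 (RDiv (rvar rMass) (rvar rRest)) = M / rest s.
  by rewrite /= rest2 massE.
apply: (@wp_flip_seq _ _ _ _ _ _ _ _ _ _ 4 0 _ _ _ v1 v0); rewrite rE.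
- apply/andP; split; first by apply: divr_ge0 => //; exact: ltW.
  by rewrite ler_pdivrMr // mul1r RMC lerDl.
- rewrite mulf_eq0 negb_or => /andP[M0 _].
  apply: wp_if => // _; apply: wp_setr_seq; apply: wp_setn_seq.
  set s3 := set_nat _ _ _ _ _.
  have pos3 : pos s3 = (pos s).+1 by rewrite /s3 /= /upd /= pos2 addn1.
  apply: wp_setn_conj; set s4 := set_nat _ _ _ _ _.
  have wE4 i : wval s4 i = if i == (pos s).+1 then 0%N else wval s i.
    by rewrite -wE2 /wval /s4 /= /upd /= pos2 addn1 andbT.
  have pos4 : pos s4 = (pos s).+1 by rewrite -pos3.
  have rest4 : rest s4 = M by rewrite /s4 /= /upd /=.
  have mean4 F : \sum_(x | candidate (pos s4) (wval s4) x) F x =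
      \sum_(x | extends (pos s).+1 (wval s) x) F x.
    by rewrite pos4 (candidateS _ wE4).
  split; first split.
    * apply: same_setn => //; apply: same_setn => //; apply: same_setr => //.
      exact: same_setn.
    * by split; rewrite ?mean4 ?pos4 ?rest4 // lt_def M0.
    * by rewrite pos4 wE4 eqxx; nia.
  by move=> i; rewrite /walk_mean mean4 rest4.
- move=> MR; have C0 : C != 0.
    apply: contraNneq MR => C0; rewrite RMC C0 addr0 divff ?subrr //.
    by apply: contraTneq R_gt0 => M0; rewrite RMC C0 M0 addr0 ltxx.
  apply: wp_if => // _; apply: (@wp_cost _ _ _ _ _ _ 2 0 3 0) => //.
  apply: wp_setr_seq; apply: wp_setn_conj; set s4 := set_nat _ _ _ _ _.
  have wE4 i : wval s4 i = w' i.
    by rewrite /w' -!wE2 /wval /s4 /= /upd /= pos2 andbT addn1.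
  have pos4 : pos s4 = pos s by rewrite -pos2.
  have rest4 : rest s4 = C.
    by rewrite /s4 /= /upd /= massE rest2 RMC addrC addKr.
  have mean4 F : \sum_(x | candidate (pos s4) (wval s4) x) F x =
      \sum_(x | candidate (pos s) w' x) F x.
    by rewrite pos4 (_ : wval s4 = w') //; exact: funext.
  split; first split.
    * apply: same_setn => //; apply: same_setr => //; apply: same_setn => //.
    * by split; rewrite ?mean4 ?pos4 ?rest4 ?(ltnW pn) // lt_def C0.
    * by rewrite pos4 wE4 /w' eqxx; nia.
  by move=> i; rewrite /walk_mean mean4 rest4.
- move=> i; rewrite /walk_mean split_mean /v1 /v0.
  have R0 : rest s != 0 by rewrite gt_eqF.
  (* When a mass vanishes, so does the corresponding numerator, which makes the quotient by 0
     harmless. *)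
  have [M0|M0] := eqVneq M 0; have [C0|C0] := eqVneq C 0.
  + by rewrite RMC M0 C0 addr0 ltxx in R_gt0.
  + rewrite [in LHS]sum_excess0 // M0 mul0r mul0r !add0r subr0 mul1r.
    by rewrite RMC M0 add0r.
  + rewrite [X in _ + X](sum_excess0 _ C0) addr0 C0 RMC C0 addr0.
    by rewrite divff // mul1r subrr mul0r addr0.
  + rewrite (_ : 1 - M / rest s = C / rest s).
      by field; rewrite M0 C0 R0.
    by rewrite -[1](divff R0) -mulrBl {1}RMC addrC addKr.
Qed.

(** An entry of [vW] outside the alphabet would leave no candidate, against positive remaining mass;
    so the default of [insubd] in [word] never shows. *)
Lemma candidate_end s : rest_ok s -> (n <= pos s)%N ->
  (forall i : 'I_n, wval s i = word s i) /\
  forall F, \sum_(x | candidate (pos s) (wval s) x) F x = F (word s).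
Proof.
move=> [pn R_gt0 RE] np; have posn : pos s = n by apply/eqP; rewrite eqn_leq pn.
have wordE x : candidate (pos s) (wval s) x = (x == word s) &&
    [forall i : 'I_n, wval s i == word s i].
  rewrite /candidate posn andb_idr; last first.
    by move=> _; apply/forallP => i; rewrite ltn_eqF.
  apply/forallP/andP => [xw|[/eqP-> /forallP ww] i]; last first.
    by apply/implyP => _; rewrite (eqP (ww i)).
  have xE (i : 'I_n) : wval s i = x i by have := xw i; rewrite ltn_ord => /eqP.
  have -> : word s = x by apply/ffunP => i; rewrite ffunE xE valKd.
  by split=> //; apply/forallP => i; rewrite xE.
have [/forallP ww|ww] := boolP [forall i : 'I_n, wval s i == word s i].
  split=> [i|F]; first exact/eqP.
  rewrite (big_pred1 (word s)) // => x; rewrite wordE andb_idr // => _.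
  exact/forallP.
move: R_gt0; rewrite RE big_pred0 ?ltxx // => x.
by rewrite wordE (negbTE ww) andbF.
Qed.

(** The law of the word is given by the means of arbitrary test functions. [rRest] ends as the
    excess of the drawn word, the denominator of its acceptance probability. *)
Lemma wp_sample_word I (psi : I -> {ffun 'I_n -> 'I_l} -> rat) s :
  input s -> net_mem arr_qnet B s ->
  rmem s rZ 0 0 = \sum_x excess P Q x -> 0 < rmem s rZ 0 0 ->
  wp G (l ^ 2) sample_word s (n * l * (Kq + 7) + 4) (n * l * 2)
    (fun s' => [/\ same NS RS s s', forall i : 'I_n, wval s' i = word s' i,
      rest s' = excess P Q (word s') & 0 < rest s'])
    (fun i s' => psi i (word s'))
    (fun i => (\sum_x excess P Q x * psi i x) / rmem s rZ 0 0).
Proof.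
move=> inp net ZE Z_gt0; pose J k s' := [/\ same NS RS s s', rest_ok s' &
  ((n - pos s') * l - wval s' (pos s') <= k)%N].
rewrite (_ : n * l * (Kq + 7) + 4 = (n * l * (Kq + 6).+1 + 1).+3)%N; last by lia.
do 2 apply: wp_setn_seq; apply: wp_setr_seq; set s0 := set_rat _ _ _ _ _.
have w0 : wval s0 0 = 0%N by rewrite /wval /s0 /= /upd.
have pos0 : pos s0 = 0%N by rewrite /s0 /= /upd.
have rest0 : rest s0 = rmem s rZ 0 0 by rewrite /s0 /= /upd.
apply: (wp_weaken (wp_while (J := J) (phi := walk_mean psi) (k := (n * l)%N)
  (K := (Kq + 6)%N) (Q := 2)
  _ _)) => [||||s' [/= nlt [_ [sm ok _]]]|i s' [/= nlt [_ [sm ok _]]]|i] //.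
- move=> k s' [sm ok mk] /= posn.
  have inps' : input s' by apply: same_input sm inp.
  have nets' : net_mem arr_qnet B s' by move=> i y x; have [_ ->] := sm.
  have {}posn : (pos s' < n)%N by rewrite -[n](input_n inps') -addn1.
  have wl := rest_ok_lt ok posn.
  case: k mk => [|k] mk; first by nia.
  exists k => //; apply: (wp_weaken (wp_walk_step psi inps' nets' ok posn)) => //.
  move=> s1 [sm1 ok1 lt1]; split=> //; [exact: same_trans sm1|lia].
- split; rewrite ?pos0 ?w0 ?subn0 //.
    by apply: same_setr => //; apply: same_setn => //; exact: same_setn.
  by split; rewrite ?pos0 // ?rest0 // candidate0.
- have inps' : input s' by apply: same_input sm inp.
  have np : (n <= pos s')%N by rewrite (input_n inps') in nlt; lia.
  have [ww sumE] := candidate_end ok np; have [_ R_gt0 RE] := ok.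
  by split=> //; rewrite RE sumE.
- have inps' : input s' by apply: same_input sm inp.
  have np : (n <= pos s')%N by rewrite (input_n inps') in nlt; lia.
  have [ww sumE] := candidate_end ok np; have [_ R_gt0 RE] := ok.
  by rewrite /walk_mean sumE RE sumE mulrC mulKf // -sumE -RE gt_eqF.
- by rewrite /walk_mean pos0 candidate0 // rest0.
Qed.

End Sampler.

(** * One trial: evaluating the word and flipping the acceptance coin *)

Definition parent_index :=
  Seq (letn vIdx (NConst 0)) (Seq (letn vPow (NConst 1))
    (for_ vK (NGet arr_npar (nvar vI) (NConst 0))
       (Seq (letn vIdx (NAdd (nvar vIdx)
               (NMul (NGet vW (NGet arr_par (nvar vI) (nvar vK)) (NConst 0))
                  (nvar vPow))))
          (letn vPow (NMul (nvar vPow) (nvar arr_l)))))).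

Definition table_entry a := RGet a (nvar vI)
  (NAdd (NMul (nvar vIdx) (nvar arr_l)) (NGet vW (nvar vI) (NConst 0))).

Definition word_probs :=
  Seq (letr rP (ROfNat (NConst 1))) (Seq (letr rQ (ROfNat (NConst 1)))
    (for_ vI (nvar arr_n) (Seq parent_index
       (Seq (letr rP (RMul (rvar rP) (table_entry arr_P)))
          (letr rQ (RMul (rvar rQ) (table_entry arr_Q))))))).

(* Adds 1 to vCnt with probability dTV / Z: a word x drawn with probability   *)
(* excess x / Z is accepted with probability max(0, P x - Q x) / excess x.    *)
Definition sample :=
  Seq sample_word (Seq word_probs
  (Seq (If (BLeR (rvar rQ) (rvar rP))
          (letr rAcc (RDiv (RSub (rvar rP) (rvar rQ)) (rvar rRest)))
          (letr rAcc (ROfNat (NConst 0))))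
  (Seq (Flip vF (NConst 0) (NConst 0) (rvar rAcc))
       (letn vCnt (NAdd (nvar vCnt) (nvar vF)))))).

Lemma big_ord_ltS (R : Type) (idx : R) (op : Monoid.com_law idx) d k
    (kd : (k < d)%N) (F : 'I_d -> R) :
  \big[op/idx]_(j < d | (j < k.+1)%N) F j =
  op (\big[op/idx]_(j < d | (j < k)%N) F j) (F (Ordinal kd)).
Proof.
rewrite (bigD1 (Ordinal kd)) //= Monoid.mulmC; congr (op _ _).
by apply: eq_bigl => j; rewrite ltnS ltn_neqAle andbC.
Qed.

Section Sample.
Variables (n : nat) (G : dag n) (l : nat) (P Q : bayes_net G l) (eps del : rat).
Hypothesis l_gt0 : (0 < l)%N.
Local Notation input := (input_mem P Q eps del).
Local Notation B := (coupled P Q l_gt0).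
Local Notation hoare := (hoare G (l ^ 2)).
Implicit Types x : {ffun 'I_n -> 'I_l}.

Lemma hoare_parent_index s (i : 'I_n) x :
  input s -> nmem s vI 0 0 = i -> (forall j : 'I_n, wval s j = x j) ->
  hoare parent_index s (n * 4 + 4) 0 (fun s' =>
    same [:: vK; vIdx; vPow] [::] s s' /\
    nmem s' vIdx 0 0 = row_index (restrict G x i)).
Proof.
move=> inp sI sW; pose d := #|parents G i|.
have dn : (d <= n)%N by rewrite -[X in (_ <= X)%N]card_ord max_card.
pose J k s' := [/\ same [:: vK; vIdx; vPow] [::] s s',
  nmem s' vIdx 0 0 = (\sum_(j < d | (j < k)%N) restrict G x i j * l ^ j)%N &
  nmem s' vPow 0 0 = (l ^ k)%N].
apply: (@hoare_weaken _ _ _ _ _ (d * 4 + 2).+2 (d * 0) _ _ (J d));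
  [|by lia|by rewrite muln0|]; last first.
  move=> s' [sm rE _]; split=> //; rewrite rE /row_index.
  by apply: eq_bigl => j; rewrite ltn_ord.
do 2 apply: wp_setn_seq; apply: (hoare_for (J := J)).
- by move=> k s' v [sm rE pE]; split=> //; exact: same_setn.
- by move=> k s' [[sn _] _ _]; rewrite /= !sn // sI (input_npar inp).
- move=> k s' kd [sm rE pE] s'K; apply: wp_setn_seq; apply: wp_setn => //.
  have [sn _] := sm; split; last by rewrite /= /upd /= s'K.
  split.
  + by do 2 apply: same_setn => //.
  + rewrite /= /upd /= rE pE s'K !sn // sI (input_par inp (Ordinal kd)).
    rewrite -/(wval s _) sW (big_ord_ltS _ kd) /= ffunE; reflexivity.
  + by rewrite /= /upd /= pE sn // (input_l inp) -expnSr.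
- split; first by do 2 apply: same_setn => //.
    by rewrite big_pred0.
  by rewrite /= upd_eq.
Qed.

Lemma hoare_word_probs s x :
  input s -> (forall j : 'I_n, wval s j = x j) ->
  hoare word_probs s (n * (n * 4 + 8) + 4) 0 (fun s' =>
    [/\ same [:: vI; vK; vIdx; vPow] [:: rP; rQ] s s',
      rmem s' rP 0 0 = bn_prob P x & rmem s' rQ 0 0 = bn_prob Q x]).
Proof.
move=> inp sW.
pose J k s' := [/\ same [:: vI; vK; vIdx; vPow] [:: rP; rQ] s s',
  rmem s' rP 0 0 = \prod_(i < n | (i < k)%N) factor P i x &
  rmem s' rQ 0 0 = \prod_(i < n | (i < k)%N) factor Q i x].
apply: (@hoare_weaken _ _ _ _ _ (n * (n * 4 + 6).+2 + 2).+2 (n * 0) _ _ (J n));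
  [|by lia|by rewrite muln0|]; last first.
  by move=> s' [sm rE qE]; split=> //; rewrite ?rE ?qE; apply: eq_bigl => j;
    rewrite ltn_ord.
have inpJ k s' : J k s' -> input s' by case=> sm _ _; apply: same_input sm inp.
do 2 apply: wp_setr_seq; apply: (hoare_for (J := J)).
- by move=> k s' v [sm pE qE]; split=> //; exact: same_setn.
- by move=> k s' /inpJ[].
- move=> k s' kn Js' s'I; have inps' := inpJ _ _ Js'; have [sm pE qE] := Js'.
  pose i := Ordinal kn.
  have s'W (j : 'I_n) : wval s' j = x j.
    by have [sn _] := sm; rewrite /wval sn //; exact: sW.
  rewrite (_ : (n * 4 + 6)%N = (n * 4 + 4 + 2)%N); last by lia.
  apply: hoare_seq (hoare_parent_index (i := i) inps' s'I s'W) _.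
  move=> s1 [sm1 idx]; apply: wp_setr_seq; apply: wp_setr => //.
  have [sn1 sr1] := sm1.
  split; last by rewrite /= sn1.
  split.
  + by do 2 apply: same_setr => //; apply: same_trans sm1.
  + rewrite /= /upd /= idx !sr1 // !sn1 // (input_l inps') s'I -/(wval s' k) (s'W i).
    have -> : rmem s' arr_P k (row_index (restrict G x i) * l + x i)%N =
      factor P i x :=
        input_P inps' (restrict G x i) (x i).
    by rewrite pE (big_ord_ltS _ kn).
  + rewrite /= /upd /= idx !sr1 // !sn1 // (input_l inps') s'I -/(wval s' k) (s'W i).
    have -> : rmem s' arr_Q k (row_index (restrict G x i) * l + x i)%N =
      factor Q i x :=
        input_Q inps' (restrict G x i) (x i).
    by rewrite qE (big_ord_ltS _ kn).
- by split; rewrite ?big_pred0 //; do 2 apply: same_setr => //.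
Qed.

Definition accept x := Num.max 0 (bn_prob P x - bn_prob Q x) / excess P Q x.

Lemma accept01 x : 0 <= accept x <= 1.
Proof.
apply/andP; split.
  by rewrite divr_ge0 ?excess_ge0 // le_max lexx.
have [e0|e0] := eqVneq (excess P Q x) 0; first by rewrite /accept e0 invr0 mulr0.
by rewrite ler_pdivrMr ?lt_def ?e0 ?excess_ge0 // mul1r diff_le_excess.
Qed.

Lemma excess_accept x :
  excess P Q x * accept x = Num.max 0 (bn_prob P x - bn_prob Q x).
Proof.
have [e0|e0] := eqVneq (excess P Q x) 0; last by rewrite mulrC divfK.
have := diff_le_excess P Q x; rewrite e0 mul0r => d_le0.
by apply/eqP; rewrite eq_le d_le0 le_max lexx.
Qed.

Local Notation NS := [:: vq; va; vb; arr_qset; vLen; vPos; vF; vW; vI; vK;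
  vIdx; vPow; vCnt].
Local Notation RS := [:: rA1; rA0; rMass; rRest; rP; rQ; rAcc].
Local Notation Kq := (n * (l * (l * 3 + 2).+2 + 2).+2 * 2 + 5)%N.
Local Notation mu := (dTV (bn_prob P) (bn_prob Q) / \sum_x excess P Q x).

(** A trial multiplies the generating function of the counter by 1 - mu + mu b. The free factor c b
    stands for the trials still to come. *)
Lemma wp_sample (c : rat -> rat) s :
  input s -> net_mem arr_qnet B s ->
  rmem s rZ 0 0 = \sum_x excess P Q x -> 0 < rmem s rZ 0 0 ->
  wp G (l ^ 2) sample s (n * l * (Kq + 7) + n * (n * 4 + 8) + 12) (n * l * 2)
    (same NS RS s)
    (fun b s' => c b * b ^+ nmem s' vCnt 0 0)
    (fun b => c b * (b ^+ nmem s vCnt 0 0 * (1 - mu + mu * b))).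
Proof.
move=> inp net ZE Z_gt0.
set K1 := (n * l * (Kq + 7))%N; set K2 := (n * (n * 4 + 8))%N.
pose psi b x := c b * (b ^+ nmem s vCnt 0 0 * (1 - accept x + accept x * b)).
apply: (@wp_weaken _ _ _ _ _ _ ((K1 + 4) + ((K2 + 4) + (2 + 2)))
  (n * l * 2 + (0 + (0 + 0)))
  _ _ (same NS RS s) _ (fun b s' => c b * b ^+ nmem s' vCnt 0 0) _
  (fun b => (\sum_x excess P Q x * psi b x) / rmem s rZ 0 0)) => //; first last.
- move=> b; rewrite ZE; have Z0 : \sum_x excess P Q x != 0 by rewrite -ZE gt_eqF.
  have -> : \sum_x excess P Q x * psi b x = c b * (b ^+ nmem s vCnt 0 0 *
      (\sum_x excess P Q x + dTV (bn_prob P) (bn_prob Q) * (b - 1))).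
    rewrite dTVE mulr_suml -big_split /= !mulr_sumr; apply: eq_bigr => x _.
    by rewrite -excess_accept /psi; ring.
  by field.
- by lia.
- by lia.
apply: wp_seq (wp_sample_word psi inp net ZE Z_gt0) _ => s1 [sm1 w1 r1 r1_gt0].
have inp1 : input s1 by apply: same_input sm1 inp.
apply: hoare_seq (hoare_word_probs inp1 w1) _ => s2 [sm2 pE qE].
have [sn2 sr2] := sm2.
apply: (@hoare_seq _ _ _ _ _ _ _ 2 0 2 0
  (eq (set_rat s2 rAcc 0 0 (accept (word n l_gt0 s1))))).
  apply: wp_if; rewrite /= pE qE => PQ; apply: wp_setr => //=.
    by rewrite pE qE sr2 // r1 /accept max_r // subr_ge0.
  by rewrite /accept max_l ?mul0r // subr_le0 ltW // ltNge.
move=> _ <-; set a := accept _; set s3 := set_rat _ _ _ _ _.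
have rE : reval s3 (rvar rAcc) = a by [].
have cnt3 : nmem s3 vCnt 0 0 = nmem s vCnt 0 0.
  by rewrite /= sn2 //; have [-> //] := sm1.
have sm3 : same NS RS s s3.
  by apply: same_setr => //; apply: same_trans sm2 => //; apply: same_trans sm1.
apply: (@wp_flip_seq _ _ _ _ _ _ _ _ _ _ 1 0 _ _ _
  (fun b => c b * b ^+ (nmem s vCnt 0 0).+1) (fun b => c b * b ^+ nmem s vCnt 0 0));
  rewrite ?rE ?accept01 //.
- move=> _; apply: wp_setn => [|b].
    by apply: same_setn => //; exact: same_setn.
  by rewrite /= /upd /= -[nmem s2 _ _ _]/(nmem s3 _ _ _) cnt3 addn1.
- move=> _; apply: wp_setn => [|b].
    by apply: same_setn => //; exact: same_setn.
  by rewrite /= /upd /= -[nmem s2 _ _ _]/(nmem s3 _ _ _) cnt3 addn0.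
- by move=> b; rewrite /psi -/a exprS; ring.
Qed.

End Sample.

(** * The complete estimator *)

Definition inverse_eps :=
  Seq (letn vJ (NConst 1))
    (While (BNot (BLeR (ROfNat (NConst 1))
        (RMul (ROfNat (nvar vJ)) (rvar arr_eps))))
       (letn vJ (NAdd (nvar vJ) (NConst 1)))).

Definition log_del :=
  Seq (letn vE (NConst 0)) (Seq (letr rX (rvar arr_del))
    (While (BNot (BLeR (ROfNat (NConst 1)) (rvar rX)))
       (Seq (letr rX (RAdd (rvar rX) (rvar rX)))
          (letn vE (NAdd (nvar vE) (NConst 1)))))).

Definition sample_count := NMul (NConst 64) (NMul (nvar arr_n)
  (NMul (NMul (nvar vJ) (nvar vJ)) (NAdd (nvar vE) (NConst 1)))).

Definition estimate :=
  Seq inverse_eps (Seq log_del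
  (Seq (letn vM sample_count)
  (Seq fill_table
  (Seq (letn vLen (NConst 0)) (Seq prefix_mass (Seq (letr rZ (rvar rMass))
  (Seq (letn vCnt (NConst 0))
  (Seq (If (BLeR (rvar rZ) (ROfNat (NConst 0))) Skip
          (for_ vSmp (nvar vM) sample))
       (letr arr_out (RDiv (RMul (rvar rZ) (ROfNat (nvar vCnt)))
          (ROfNat (nvar vM)))))))))))).

Section Estimate.
Variables (n : nat) (G : dag n) (l : nat) (P Q : bayes_net G l) (eps del : rat).
Hypothesis l_gt0 : (0 < l)%N.
Local Notation input := (input_mem P Q eps del).
Local Notation B := (coupled P Q l_gt0).
Local Notation hoare := (hoare G (l ^ 2)).

Definition least_inverse (j : nat) := [/\ (0 < j)%N, 1 <= j%:R * eps &
  forall k, (0 < k)%N -> 1 <= k%:R * eps -> (j <= k)%N].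

Definition least_log (j : nat) := 1 <= 2 ^+ j * del /\
  forall k, 1 <= 2 ^+ k * del -> (j <= k)%N.

Lemma hoare_inverse_eps s j :
  input s -> least_inverse j ->
  hoare inverse_eps s (j * 2 + 2) 0 (fun s' =>
    same [:: vJ] [::] s s' /\ nmem s' vJ 0 0 = j).
Proof.
move=> inp [j_gt0 jeps jmin].
pose J k s' := [/\ same [:: vJ] [::] s s', (0 < nmem s' vJ 0 0)%N &
  (j - nmem s' vJ 0 0 = k /\ nmem s' vJ 0 0 <= j)%N].
apply: (@hoare_weaken _ _ _ _ _ ((j - 1) * 2 + 1).+1 ((j - 1) * 0) _ _
  (fun s' => ~~ beval s' (BNot (BLeR (ROfNat (NConst 1))
        (RMul (ROfNat (nvar vJ)) (rvar arr_eps)))) /\ exists k, J k s'));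
  [|by lia|by rewrite muln0|]; last first.
  move=> s' [/= + [k [[sn sr] s'J0 [_ s'J]]]]; rewrite negbK sr // (input_eps inp).
  by split=> //; apply/eqP; rewrite eqn_leq s'J jmin.
apply: wp_setn_seq; apply: (wp_while (J := J)) => [k s' [sm s'J0 [s'Jk s'J]] /= ok|].
  have ltj : (nmem s' vJ 0 0 < j)%N.
    rewrite ltn_neqAle s'J andbT; apply: contraNneq ok => ->.
    by have [_ ->] := sm; rewrite // (input_eps inp).
  exists (j - (nmem s' vJ 0 0).+1)%N; first by lia.
  apply: wp_setn => //; split; first exact: same_setn.
    by rewrite /= upd_eq addn1.
  by rewrite /= upd_eq addn1.
split; first exact: same_setn.
  by [].
by split; rewrite /= upd_eq.
Qed.

Lemma hoare_log_del s j :
  input s -> least_log j ->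
  hoare log_del s (j * 3 + 3) 0 (fun s' =>
    same [:: vE] [:: rX] s s' /\ nmem s' vE 0 0 = j).
Proof.
move=> inp [jdel jmin].
pose J k s' := [/\ same [:: vE] [:: rX] s s',
  rmem s' rX 0 0 = 2 ^+ nmem s' vE 0 0 * del &
  (j - nmem s' vE 0 0 = k /\ nmem s' vE 0 0 <= j)%N].
apply: (@hoare_weaken _ _ _ _ _ (j * 3 + 1).+2 (j * 0) _ _
  (fun s' => ~~ beval s' (BNot (BLeR (ROfNat (NConst 1)) (rvar rX))) /\
     exists k, J k s'));
  [|by lia|by rewrite muln0|]; last first.
  move=> s' [/= + [k [[sn sr] s'X [_ s'E]]]]; rewrite negbK s'X => ok.
  by split=> //; apply/eqP; rewrite eqn_leq s'E jmin.
apply: wp_setn_seq; apply: wp_setr_seq.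
apply: (wp_while (J := J)) => [k s' [sm s'X [s'Ek s'E]] /= ok|].
  have ltj : (nmem s' vE 0 0 < j)%N.
    rewrite ltn_neqAle s'E andbT; apply: contraNneq ok => s'Ej.
    by rewrite s'X s'Ej.
  exists (j - (nmem s' vE 0 0).+1)%N; first by lia.
  apply: wp_setr_seq; apply: wp_setn => //; split.
    by apply: same_setn => //; exact: same_setr.
    by rewrite /= /upd /= s'X addn1 exprS; ring.
  by rewrite /= /upd /= addn1.
split; first by apply: same_setr => //; exact: same_setn.
  by rewrite /= /upd /= (input_del inp) expr0 mul1r.
by rewrite /= /upd /= subn0.
Qed.

Local Notation d := (dTV (bn_prob P) (bn_prob Q)).
Local Notation Z := (\sum_x excess P Q x).
Local Notation Kq := (n * (l * (l * 3 + 2).+2 + 2).+2 * 2 + 5)%N.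

Lemma wp_estimate s j e K0 :
  input s -> least_inverse j -> least_log e ->
  (forall i, (l ^ 2) ^ #|parents G i| * (l * (l * 6 + 2).+2 + 2).+2 + 2 <= K0)%N ->
  let M := (64 * (n * (j * j * (e + 1))))%N in
  wp G (l ^ 2) estimate s
    (j * 2 + e * 3 + n * (K0 + n * 3 + 6) + Kq +
     M * (n * l * (Kq + 7) + n * (n * 4 + 8) + 14) + 20)
    (2 + M * (n * l * 2))
    (fun s' => rmem s' arr_out 0 0 = Z * (nmem s' vCnt 0 0)%:R / M%:R /\
       (Z = 0 -> nmem s' vCnt 0 0 = 0%N))
    (fun b s' => b ^+ nmem s' vCnt 0 0)
    (fun b => (1 - d / Z + d / Z * b) ^+ M).
Proof.
move=> inp lej lee leK0 M.
set Ks := (n * l * (Kq + 7) + n * (n * 4 + 8) + 12)%N.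
apply: (@wp_cost _ _ _ _ _ _ ((j * 2 + 2) + ((e * 3 + 3) +
  ((n * (K0 + n * 3 + 6) + 2 + (Kq + ((M * Ks.+2 + 2).+1 + 1).+2).+1).+1)))
  (0 + (0 + (0 + (2 + (M * (n * l * 2) + 0)))))); [|by rewrite /Ks; lia|by lia].
apply: hoare_seq (hoare_inverse_eps inp lej) _ => s1 [sm1 s1J].
have inp1 : input s1 by apply: same_input sm1 inp.
apply: hoare_seq (hoare_log_del inp1 lee) _ => s2 [sm2 s2E].
have inp2 : input s2 by apply: same_input sm2 inp1.
apply: wp_setn_seq.
have -> : neval s2 sample_count = M.
  have [sn2 _] := sm2.
  by rewrite -[neval _ _]/(64 * (nmem s2 arr_n 0 0 * (nmem s2 vJ 0 0 *
    nmem s2 vJ 0 0 * (nmem s2 vE 0 0 + 1))))%N (input_n inp2) s2E sn2 // s1J.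
set s3 := set_nat _ _ _ _ _.
have inp3 : input s3 by apply: (same_input (N := [:: vM]) (R := [::])) inp2 => //;
  exact: same_setn.
apply: hoare_seq (hoare_fill_table l_gt0 inp3 leK0) _ => s4 [sm4 net4].
have inp4 : input s4 by apply: same_input sm4 inp3.
apply: wp_setn_seq; set s5 := set_nat _ _ _ _ _.
have inp5 : input s5 by apply: (same_input (N := [:: vLen]) (R := [::])) inp4 => //;
  exact: same_setn.
apply: hoare_seq (hoare_prefix_mass (P := P) (Q := Q) (l_gt0 := l_gt0) inp5 net4) _.
move=> s6 [sm6 massE].
(* [vLen] is 0: the prefix is empty and every word extends it. *)
have {}massE : rmem s6 rMass 0 0 = Z.
  by rewrite massE; apply: eq_bigl => x; apply/forallP.
apply: wp_setr_seq; apply: wp_setn_seq; set s7 := set_nat _ _ _ _ _.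
have sm47 : same [:: vq; va; vb; arr_qset; vLen; vCnt]
    [:: rA1; rA0; rMass; rZ] s4 s7.
  apply: same_setn => //; apply: same_setr => //; apply: same_trans sm6 => //.
  exact: same_setn.
have s7M : nmem s7 vM 0 0 = M.
  by have [-> //] := sm47; have [-> //] := sm4; rewrite /= upd_eq.
have s7Z : rmem s7 rZ 0 0 = Z by rewrite /= /upd /= massE.
have s7C : nmem s7 vCnt 0 0 = 0%N by [].
have inp7 : input s7 by apply: same_input sm47 inp4.
have net7 : net_mem arr_qnet B s7 by move=> i y x; have [_ ->] := sm47.
have Z_ge0 : 0 <= Z by apply: sumr_ge0 => x _; exact: excess_ge0.
move: s7 s7M s7Z s7C inp7 net7 {sm47} => s7 s7M s7Z s7C inp7 net7.
pose NS := [:: vSmp; vq; va; vb; arr_qset; vLen; vPos; vF; vW; vI; vK;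
  vIdx; vPow; vCnt].
pose RS := [:: rA1; rA0; rMass; rRest; rP; rQ; rAcc].
pose end_ok s' := [/\ rmem s' rZ 0 0 = Z, nmem s' vM 0 0 = M &
  (Z = 0 -> nmem s' vCnt 0 0 = 0%N)].
apply: (@wp_seq _ _ _ _ _ _ _ _ _ 1 0 end_ok _ (fun b s' => b ^+ nmem s' vCnt 0 0)).
  (* If Z = 0 no trial is run, and the formula survives because d / Z is 0 by convention. *)
  apply: wp_if; rewrite /= s7Z => Z0.
    have {}Z0 : Z = 0 by apply/eqP; rewrite eq_le Z0.
    apply: (wp_weaken (@wp_skip _ G (l ^ 2) _ s7 end_ok
      (fun b s' => b ^+ nmem s' vCnt 0 0) _)) => // b.
    by rewrite s7C Z0 invr0 mulr0 subr0 mul0r addr0 expr1n.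
  have Z_gt0 : 0 < Z by rewrite ltNge.
  (* Mean of b to the final count, given the count so far and the number of trials left. *)
  pose phi b s' := (1 - d / Z + d / Z * b) ^+ (M - nmem s' vSmp 0 0) *
    b ^+ nmem s' vCnt 0 0.
  pose J k s' := same NS RS s7 s' /\ (k <= M)%N.
  apply: (wp_weaken (wp_for (N := M) (K := Ks) (Q := (n * l * 2)%N) (J := J)
    (phi := phi) _ _ _ _)) => //.
  - by move=> k s' v [sm leM]; split=> //; exact: same_setn.
  - by move=> k s' [[sn _] _]; rewrite /= sn.
  - move=> k s' kM [sm _] s'S; have [sn sr] := sm.
    have inps' : input s' by apply: same_input sm inp7.
    have nets' : net_mem arr_qnet B s' by move=> i y x; rewrite sr.
    have s'Z : rmem s' rZ 0 0 = Z by rewrite sr.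
    apply: (wp_weaken (wp_sample (P := P) (Q := Q)
      (fun b => (1 - d / Z + d / Z * b) ^+ (M - k.+1)) inps' nets' s'Z _)) => //.
    + by rewrite s'Z.
    + move=> s'' sm''; split; last by have [-> //] := sm''.
      by split=> //; apply: same_trans sm''.
    + by move=> b; rewrite /phi s'S -(subnSK kM) exprS; ring.
  - move=> s' [[[sn sr] _] _]; split; [by rewrite sr|by rewrite sn|].
    by move=> Z_eq0; rewrite Z_eq0 ltxx in Z_gt0.
  - by move=> b s' [_ s'S]; rewrite /phi s'S subnn mul1r.
  - by move=> b; rewrite /phi /= /upd /= subn0 s7C expr0 mulr1.
move=> s8 [s8Z s8M s8C]; apply: wp_setr => //.
by rewrite /= /upd /= s8Z s8M.
Qed.
End Estimate.

(** * Tail bounds *)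

Section Tails.
Variables (R : realType) (T : Type) (mu : dist T).
Hypothesis mu_ge0 : forall o, List.In o mu -> 0 <= o.1.

Lemma dprob_markov (E : pred T) (f : T -> rat) (C : R) :
  (forall x, 0 <= f x) ->
  (forall x, E x -> C <= ratr (f x)) ->
  C * ratr (dprob mu E) <= ratr (\sum_(o <- mu) o.1 * f o.2).
Proof.
move=> f0 Ef; rewrite /dprob; elim: mu mu_ge0 => [|o s IHs] s0.
  by rewrite !big_nil !rmorph0 mulr0.
have {}IHs := IHs (fun o os => s0 o (or_intror os)).
rewrite !big_cons; case: ifP => [/Ef Co|_]; rewrite !rmorphD /=; last first.
  by rewrite -[leLHS]add0r lerD // ler0q mulr_ge0 // s0 //; left.
rewrite mulrDr lerD // rmorphM /= mulrC ler_wpM2l // ler0q.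
by apply: s0; left.
Qed.

Lemma dprob_union (E1 E2 E3 : pred T) :
  (forall o, List.In o mu -> [|| E1 o.2, E2 o.2 | E3 o.2]) ->
  \sum_(o <- mu) o.1 <= dprob mu E1 + dprob mu E2 + dprob mu E3.
Proof.
rewrite /dprob; elim: mu mu_ge0 => [|o s IHs] s0 cov.
  by rewrite !big_nil !addr0.
have {}IHs := IHs (fun o os => s0 o (or_intror os)) (fun o os => cov o (or_intror os)).
have o0 : 0 <= o.1 by apply: s0; left.
have : [|| E1 o.2, E2 o.2 | E3 o.2] by apply: cov; left.
by rewrite !big_cons; case: (E1 _) => /=; case: (E2 _) => /=; case: (E3 _) => //= _; lra.
Qed.

(* With b = 1 / (1 - s) >= exp s, the identity E b^X = (1 - p + p b)^M gives  *)
(* the Chernoff bound for the upper tail if s > 0 and the lower if s < 0.     *)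
Lemma chernoff (X : T -> nat) (M : nat) (p s : rat) (E : pred T) :
  0 <= p <= 1 -> - 1 / 2 <= s <= 1 / 2 ->
  (forall b : rat, \sum_(o <- mu) o.1 * b ^+ X o.2 = (1 - p + p * b) ^+ M) ->
  (forall x, E x -> 4 * s ^+ 2 * (M%:R * p) <= s * ((X x)%:R - M%:R * p)) ->
  ratr (dprob mu E) <= expR (ratr (- (2 * s ^+ 2 * (M%:R * p)))) :> R.
Proof.
move=> /andP[p0 p1] /andP[sl sr] mgf Es.
pose b := (1 - s)^-1; have s1 : 0 < 1 - s by lra.
have b0 : 0 < b by rewrite invr_gt0.
have expb : expR (ratr s) <= ratr b :> R.
  rewrite /b fmorphV rmorphB rmorph1 /= -[expR _]invrK -expRN lef_pV2 ?posrE ?expR_gt0 //.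
    by apply: le_trans (expR_ge1Dx _); rewrite lexx.
  by rewrite -(rmorph1 ratr) -rmorphB ltr0q.
(* On E, b^X >= exp(s X) >= C. Dividing the moment bound exp(M p (s + 2 s^2)) by C leaves exp(- 2
   s^2 M p). *)
pose C := expR (ratr (4 * s ^+ 2 * (M%:R * p) + s * (M%:R * p))) : R.
have leC x : E x -> C <= ratr (b ^+ X x).
  move=> /Es Ex; apply: (@le_trans _ _ (expR (ratr (s * (X x)%:R)))).
    by rewrite ler_expR ler_rat; lra.
  rewrite rmorphM /= ratr_nat mulrC expRM_natl rmorphXn /=.
  by apply: lerXn2r => //; rewrite nnegrE ?expR_ge0 // ler0q ltW.
have := dprob_markov (fun x => exprn_ge0 (X x) (ltW b0)) leC.
rewrite mgf => le1.
have base0 : 0 <= 1 - p + p * b by rewrite addr_ge0 ?subr_ge0 // mulr_ge0 // ltW.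
have le2 : ratr ((1 - p + p * b) ^+ M) <=
    expR (ratr (M%:R * p * (s + 2 * s ^+ 2))) :> R.
  rewrite -mulrA [ratr (_ * _)]rmorphM /= ratr_nat expRM_natl rmorphXn.
  apply: lerXn2r; rewrite ?nnegrE ?expR_ge0 ?ler0q //=.
  apply: (@le_trans _ _ (1 + ratr (p * (s + 2 * s ^+ 2)))); last exact: expR_ge1Dx.
  have -> : 1 + ratr (p * (s + 2 * s ^+ 2)) = ratr (1 + p * (s + 2 * s ^+ 2)) :> R.
    by rewrite [RHS]rmorphD rmorph1.
  rewrite ler_rat.
  (* Multiplied by 1 - s this is s^2 (1 - 2 s) >= 0, where s <= 1 / 2 enters. *)
  suff : b - 1 <= s + 2 * s ^+ 2 by nra.
  rewrite lerBlDr /b -[leLHS]mul1r ler_pdivrMr //; nra.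
have C0 : 0 < C by exact: expR_gt0.
rewrite -(ler_pM2l C0); apply: le_trans le1 (le_trans le2 _).
by rewrite /C -expRD -rmorphD ler_expR ler_rat; lra.
Qed.

End Tails.

(** * Relative accuracy of the estimate *)

Section Accuracy.
Variables (R : realType) (T : Type) (mu : dist T) (X : T -> nat) (out : T -> rat).

Lemma expRN_le_half (e : nat) (del : rat) :
  1 <= 2 ^+ e * del -> expR (- (e + 1)%:R) <= ratr (del / 2) :> R.
Proof.
move=> edel; have e2 : 2 <= expR 1 :> R.
  by apply: le_trans (expR_ge1Dx _); rewrite -natr1 addrC.
have -> : - (e + 1)%:R = (e + 1)%:R * (- 1) :> R by rewrite mulrN1.
rewrite expRM_natl expRN exprVn.
apply: (@le_trans _ _ ((2 ^+ (e + 1))^-1)).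
  rewrite lef_pV2 ?posrE ?exprn_gt0 ?expR_gt0 // lerXn2r // nnegrE ?expR_ge0 //.
have <- : ratr ((2 ^+ (e + 1))^-1) = (2 ^+ (e + 1))^-1 :> R.
  by rewrite fmorphV rmorphXn /= (ratr_nat _ 2).
rewrite ler_rat exprD expr1 invfM ler_pM2r ?invr_gt0 //.
by rewrite -[leLHS]mul1r ler_pdivrMr ?exprn_gt0 // mulrC.
Qed.

(** With s = 1 / (8 j), allow X a relative deviation 4 s from its mean M p. The factor 64 makes the
    Chernoff exponent 2 s^2 M p equal to 2 n p (e + 1) >= e + 1, since p >= 1 / (2 n); each tail
    then has probability at most del / 2. The deviation is small enough because 8 s <= 1 and 8 s <=
    eps, so that (1 - 4 s) (1 + 8 s) >= 1. *)
Lemma estimate_accuracy (n j e M : nat) (d Z eps del : rat) :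
  M = (64 * (n * (j * j * (e + 1))))%N ->
  (0 < n)%N -> (0 < j)%N -> 0 < eps -> 0 < del ->
  1 <= j%:R * eps -> 1 <= 2 ^+ e * del ->
  0 <= d -> d <= Z -> Z <= 2 * n%:R * d ->
  (forall o, List.In o mu -> 0 <= o.1) -> \sum_(o <- mu) o.1 = 1 ->
  (forall o, List.In o mu -> out o.2 = Z * (X o.2)%:R / M%:R /\
     (Z = 0 -> X o.2 = 0%N)) ->
  (forall b : rat, \sum_(o <- mu) o.1 * b ^+ X o.2 = (1 - d / Z + d / Z * b) ^+ M) ->
  1 - del <= dprob mu (fun c => (d / (1 + eps) <= out c) && (out c <= (1 + eps) * d)).
Proof.
move=> ME n0 j0 eps0 del0 jeps edel d0 dZ Zd mu0 mu1 outE mgf.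
set good := (fun c => _).
have M0 : 0 < M%:R :> rat by rewrite ltr0n ME !muln_gt0 n0 j0 addn1.
have jq : 0 < j%:R :> rat by rewrite ltr0n.
have nq : 0 < n%:R :> rat by rewrite ltr0n.
(* Z = 0 forces d = 0, and the output is then exactly 0. *)
have [Z0|Z0] := eqVneq Z 0.
  have dz : d = 0 by apply/eqP; rewrite eq_le d0 andbT -Z0.
  have := @dprob_union _ _ mu0 good pred0 pred0.
  rewrite mu1 /dprob !big_pred0_eq !addr0 => le1.
  apply: le_trans (le1 _); first by lra.
  move=> o /outE[oE /(_ Z0) X0]; rewrite /good oE Z0 dz.
  by rewrite !mul0r mulr0 lexx.
have Zgt0 : 0 < Z by rewrite lt_def Z0 (le_trans d0).
have dgt0 : 0 < d.
  rewrite lt_def d0 andbT; apply: contraTneq Zgt0 => dz.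
  by rewrite -leNgt; move: Zd; rewrite dz mulr0.
set p := d / Z in mgf.
have p0 : 0 < p by rewrite divr_gt0.
have p1 : p <= 1 by rewrite ler_pdivrMr // mul1r.
have Zp : Z * p = d by rewrite /p mulrC divfK.
move: (p) p0 p1 Zp mgf => {}p p0 p1 Zp mgf.
have [s s0 js] : exists2 s : rat, 0 < s & j%:R * s = 1 / 8.
  exists (8 * j%:R)^-1; first by rewrite invr_gt0 mulr_gt0.
  by rewrite invfM mulrCA mulfV ?gt_eqF // mulr1 div1r.
have s8 : 8 * s <= 1.
  have : 1 * s <= j%:R * s by rewrite (ler_pM2r s0) ler1n.
  by rewrite js; lra.
have s_eps : 8 * s <= eps.
  have : 1 * s <= j%:R * eps * s by rewrite (ler_pM2r s0).
  by rewrite mulrAC js; lra.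
pose hi x := M%:R * p * (1 + 4 * s) <= (X x)%:R.
pose lo x := (X x)%:R <= M%:R * p * (1 - 4 * s).
have tail s' (E : pred T) : s' ^+ 2 = s ^+ 2 -> - 1 / 2 <= s' <= 1 / 2 ->
    (forall x, E x -> 4 * s' ^+ 2 * (M%:R * p) <= s' * ((X x)%:R - M%:R * p)) ->
    dprob mu E <= del / 2.
  move=> s's s'h Es; rewrite -(ler_rat R).
  have p01 : 0 <= p <= 1 by rewrite ltW.
  apply: le_trans (chernoff R mu0 p01 s'h mgf Es) (le_trans _ (expRN_le_half edel)).
  rewrite ler_expR -(ratr_nat R (e + 1)) -rmorphN ler_rat lerN2 s's.
  have -> : M%:R = 64 * n%:R * j%:R ^+ 2 * (e + 1)%:R :> rat.
    by rewrite ME !natrM; ring.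
  have -> : 2 * s ^+ 2 * (64 * n%:R * j%:R ^+ 2 * (e + 1)%:R * p) =
      128 * (j%:R * s) ^+ 2 * (n%:R * p) * (e + 1)%:R :> rat by ring.
  rewrite js; apply: ler_peMl; first exact: ler0n.
  have : Z * 1 <= Z * (2 * n%:R * p) by rewrite mulr1 mulrCA Zp.
  have -> : 128 * (1 / 8) ^+ 2 * (n%:R * p) = 2 * n%:R * p :> rat by field.
  by rewrite (ler_pM2l Zgt0).
have s_half : - 1 / 2 <= s <= 1 / 2 by apply/andP; split; lra.
have sN_half : - 1 / 2 <= - s <= 1 / 2 by apply/andP; split; lra.
have hi_le : dprob mu hi <= del / 2.
  apply: (tail s _ erefl s_half) => x; rewrite /hi => hx.
  have -> : 4 * s ^+ 2 * (M%:R * p) = s * (4 * s * (M%:R * p)) by ring.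
  by rewrite (ler_pM2l s0); lra.
have lo_le : dprob mu lo <= del / 2.
  apply: (tail _ _ (sqrrN s) sN_half) => x; rewrite /lo => lx.
  rewrite sqrrN mulNr -mulrN.
  have -> : 4 * s ^+ 2 * (M%:R * p) = s * (4 * s * (M%:R * p)) by ring.
  by rewrite (ler_pM2l s0); lra.
have := @dprob_union _ _ mu0 good hi lo; rewrite mu1 => le1.
suff cov : forall o, List.In o mu -> [|| good o.2, hi o.2 | lo o.2].
  by have := le1 cov; lra.
move=> o /outE[oE _]; rewrite orbC -implyNb; apply/implyP.
rewrite negb_or /hi /lo -!ltNge => /andP[hx lx].
pose y := (X o.2)%:R / M%:R : rat.
have Xy : (X o.2)%:R = M%:R * y by rewrite /y mulrC divfK // gt_eqF.
rewrite Xy -mulrA ltr_pM2l // in hx; rewrite Xy -mulrA ltr_pM2l // in lx.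
have oy : out o.2 = Z * y by rewrite oE /y mulrA.
have hx' : Z * y < d * (1 + 4 * s) by rewrite -Zp -mulrA ltr_pM2l.
have lx' : d * (1 - 4 * s) < Z * y by rewrite -Zp -mulrA ltr_pM2l.
rewrite /good oy; apply/andP; split.
  have eps1 : 0 < 1 + eps by lra.
  rewrite (ler_pdivrMr _ _ eps1).
  have s4 : 0 <= 1 - 4 * s by lra.
  have s48 : 0 <= 4 * s * (1 - 8 * s).
    by apply: mulr_ge0; lra.
  apply: (@le_trans _ _ (d * (1 - 4 * s) * (1 + 8 * s))).
    have -> : d * (1 - 4 * s) * (1 + 8 * s) = d + d * (4 * s * (1 - 8 * s)) by ring.
    by rewrite lerDl (mulr_ge0 d0 s48).
  by apply: ler_pM (mulr_ge0 d0 s4) _ (ltW lx') _; lra.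
apply: ltW; apply: lt_le_trans hx' _; rewrite mulrC (ler_pM2r dgt0); lra.
Qed.

End Accuracy.

(** * Cost and conclusion *)

Section Cost.
Variable R : realType.

Lemma least_inverse_exists (eps : rat) : 0 < eps -> exists j, least_inverse eps j.
Proof.
move=> eps0; pose ok k := (0 < k)%N && (1 <= k%:R * eps).
have ex_ok : exists k, ok k.
  exists (Num.bound eps^-1); have := archi_boundP (ltW (_ : 0 < eps^-1)).
  rewrite invr_gt0 => /(_ eps0) lt_b; apply/andP; split.
    by rewrite -(ltr0n rat); apply: lt_trans lt_b; rewrite invr_gt0.
  by rewrite -ler_pdivrMr // div1r ltW.
have := ex_minnP ex_ok => -[j /andP[j0 jeps] jmin].
by exists j; split=> // k k0 keps; apply: jmin; rewrite /ok k0.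
Qed.

Lemma least_log_exists (del : rat) : 0 < del -> exists e, least_log del e.
Proof.
move=> del0; pose ok k := (1 <= 2 ^+ k * del).
have ex_ok : exists k, ok k.
  exists (Num.bound del^-1); have := archi_boundP (ltW (_ : 0 < del^-1)).
  rewrite invr_gt0 => /(_ del0) lt_b.
  rewrite /ok -ler_pdivrMr // div1r (le_trans (ltW lt_b)) //.
  by rewrite -natrX ler_nat ltnW // ltn_expl.
by have := ex_minnP ex_ok => -[e eok emin]; exists e; split.
Qed.

(** By minimality (j - 1) eps <= 1, so j <= 2 if eps >= 1, and j eps <= 2 otherwise. *)
Lemma least_inverse_le (eps : rat) j : 0 < eps -> least_inverse eps j ->
  (j * j)%:R <= 4 * Num.max 1 (ratr eps ^- 2) :> R.
Proof.
move=> eps0 [j0 _ jmin]; set a : R := ratr eps.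
have a0 : 0 < a by rewrite ltr0q.
have ja : (j%:R - 1) * a <= 1.
  have [j1|j1] := leqP j 1.
    have -> : j = 1%N by apply/eqP; rewrite eqn_leq j1.
    by rewrite subrr mul0r.
  have : ~~ (1 <= (j.-1)%:R * eps).
    by apply/negP => /(jmin _ _); rewrite -ltnS prednK // j1 => /(_ isT); lia.
  rewrite -ltNge => /ltW; rewrite -(ler_rat R) rmorphM rmorph1 /= ratr_nat.
  by rewrite -subn1 natrB.
have j1 : 1 <= j%:R :> R by rewrite ler1n.
rewrite natrM; have [a1|a1] := leP 1 a.
  apply: (@le_trans _ _ (4 * 1)).
    have : j%:R <= 2 :> R by nra.
    by nra.
  by rewrite ler_wpM2l // le_max lexx.
apply: (@le_trans _ _ (4 * a ^- 2)); last by rewrite ler_wpM2l // le_max lexx orbT.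
rewrite ler_pdivlMr ?exprn_gt0 //.
have : j%:R * a <= 2 by lra.
have : 0 <= j%:R * a by rewrite mulr_ge0 // ltW.
nra.
Qed.

(** If e > 0, then 2^(e - 1) < 1 / del by minimality, and exp(1 / 2) <= 2 turns this into (e - 1) /
    2 <= ln(1 / del). *)
Lemma least_log_le (del : rat) e : 0 < del -> least_log del e ->
  (e + 1)%:R <= 4 * Num.max 1 (ln (ratr del)^-1) :> R.
Proof.
move=> del0 [_ emin]; set L := ln _.
have L1 : 1 <= Num.max 1 L by rewrite le_max lexx.
have LL : L <= Num.max 1 L by rewrite le_max lexx orbT.
rewrite addn1; case: e emin => [|e] emin; first by lra.
have : ~~ (1 <= 2 ^+ e * del) by apply/negP => /emin; rewrite ltnn.
rewrite -ltNge -ltr_pdivlMr // div1r => /ltW e_del.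
have exp_half : expR (1 / 2) <= 2 :> R.
  rewrite -[expR _]invrK -expRN -[2]invrK lef_pV2 ?posrE ?invr_gt0 ?expR_gt0 //.
  by apply: le_trans (expR_ge1Dx _); lra.
have : e%:R * (1 / 2) <= L.
  rewrite -ler_expR lnK ?posrE ?invr_gt0 ?ltr0q // expRM_natl.
  rewrite -fmorphV; apply: le_trans (_ : 2 ^+ e <= _).
    by apply: lerXn2r; rewrite ?nnegrE ?expR_ge0.
  by rewrite -(ratr_nat R 2) -rmorphXn ler_rat.
by move=> eL; rewrite -addn2 natrD; lra.
Qed.

Lemma sample_size_le n l (eps del : rat) j e : 0 < eps -> 0 < del ->
  least_inverse eps j -> least_log del e ->
  (n ^ 3 * (j * j) * l * (e + 1))%:R <= 16 * cost_bound R n l eps del.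
Proof.
move=> eps0 del0 /(least_inverse_le eps0) jle /(least_log_le del0) ele.
rewrite (natrM _ _ (e + 1)%N) (natrM _ _ l) (natrM _ _ (j * j)%N) natrX.
rewrite /cost_bound.
set a := Num.max 1 _ in jle *; set b := Num.max 1 _ in ele *.
have n0 : 0 <= n%:R ^+ 3 :> R by rewrite exprn_ge0.
apply: (@le_trans _ _ (n%:R ^+ 3 * (4 * a) * l%:R * (4 * b))); last by nra.
apply: ler_pM => //; first by rewrite !mulr_ge0.
by rewrite ler_wpM2r // ler_wpM2l.
Qed.

End Cost.

(** Along the ancestral induction a source stays one, since an added node is a parent of no earlier
    node. *)
Lemma exists_source n (G : dag n) : (0 < n)%N -> exists i, parents G i = set0.
Proof.
move=> n0.
have := @ancestral_ind n G (fun D => D != set0 ->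
  exists2 i, i \in D & forall j, j \in D -> j \notin parents G i).
case=> [|i D iD par IHD _||i _ src].
- by rewrite eqxx.
- have [->|/IHD[i' i'D src]] := eqVneq D set0.
    exists i; rewrite ?inE ?eqxx // => j; rewrite !inE orbF => /eqP->.
    by have := notin_parents G i; rewrite inE.
  exists i'; first by rewrite !inE i'D orbT.
  move=> j; rewrite in_setU1 => /orP[/eqP->|/src //].
  by apply: par; rewrite !inE i'D orbT.
- by apply/set0Pn; exists (Ordinal n0); rewrite inE.
- by exists i; apply/setP => j; rewrite [RHS]inE; apply/negbTE/src; rewrite inE.
Qed.

(** Over the empty alphabet a node with parents carries no condition, but a source has the empty
    assignment, whose row would sum to 0 instead of 1. *)
Lemma alphabet_gt0 n (G : dag n) l : (0 < n)%N -> bayes_net G l -> (0 < l)%N.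
Proof.
move=> n0 P; case: l P => // P; have [i pi0] := exists_source G n0.
have no_parent (k : 'I_#|parents G i|) : False.
  by case: k => k; rewrite pi0 cards0.
pose y : passign G 0 i := [ffun k => match no_parent k with end].
by have := cpt_sum1 P y; rewrite big_ord0 => /eqP; rewrite eq_sym oner_eq0.
Qed.

Lemma query_size_ge n (G : dag n) m i :
  (m ^ #|parents G i|.+1 <= query_size G m)%N.
Proof.
rewrite /query_size (bigD1 i) //= -!addnA; exact: leq_addr.
Qed.

Lemma query_size_ge_sum n (G : dag n) m : (n * m <= query_size G m)%N.
Proof.
rewrite -[X in (X * _)%N]card_ord -sum_nat_const; apply: leq_sum => i _.
exact: leq_addl.
Qed.

(** N is the query size, T the time of a query. The O(n j^2 (e + 1)) trials of at most 2 n l queries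
    each stay a factor n below X, up to constants. A walk step does O(N) work of its own, so a trial
    takes O(n l T); filling the tables takes O(n N). *)
Lemma running_time_bound : exists C : nat, forall n l j e N T q t : nat,
  (0 < n)%N -> (0 < l)%N -> (0 < j)%N -> (n * l ^ 2 <= N)%N -> (N <= T)%N ->
  let M := (64 * (n * (j * j * (e + 1))))%N in
  let Kq := (n * (l * (l * 3 + 2).+2 + 2).+2 * 2 + 5)%N in
  let X := (n ^ 3 * (j * j) * l * (e + 1))%N in
  (q <= 2 + M * (n * l * 2))%N ->
  (t <= j * 2 + e * 3 + n * (16 * N + n * 3 + 6) + Kq +
     M * (n * l * (Kq + 7) + n * (n * 4 + 8) + 14) + 20)%N ->
  (q <= C * X)%N /\ (t + q * T <= C * (T * X))%N.
Proof.
exists (64 * 100)%N => n l j e N T q t n0 l0 j0 nlN NT M Kq X.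
have nN : (n <= N)%N by nia.
have N0 : (0 < N)%N by lia.
have KqN : (Kq <= 27 * N)%N.
  have : (Kq <= 22 * (n * l ^ 2) + 5)%N.
    suff : (n * (l * (l * 3 + 2).+2 + 2).+2 <= n * (11 * l ^ 2))%N by rewrite /Kq; lia.
    by rewrite leq_pmul2l // -mulnn; nia.
  by lia.
pose Y := (j * j * (e + 1))%N.
have Y0 : (0 < Y)%N by rewrite !muln_gt0 j0 addn1.
have XE : X = (n ^ 3 * l * Y)%N by rewrite /X /Y; lia.
have n3 : (n * n <= n ^ 3)%N by rewrite (leq_pexp2l n0 (leqnSn 2)).
have nX : (n * n * l * Y <= X)%N by rewrite XE !leq_pmul2r //.
have X0 : (0 < X)%N by rewrite XE (muln_gt0 _ Y) (muln_gt0 _ l) expn_gt0 n0 l0.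
have n_le : (n <= X)%N by nia.
have j_le : (j <= X)%N by apply: leq_trans nX; rewrite /Y; nia.
have e_le : (e <= X)%N by apply: leq_trans nX; rewrite /Y; nia.
have ME : M = (64 * (n * Y))%N by [].
have q1 : (M * (n * l * 2) <= 128 * X)%N by rewrite ME; lia.
have t1 : (M * (n * l * (Kq + 7) + n * (n * 4 + 8) + 14) <= 64 * 60 * (T * X))%N.
  have inner : (n * l * (Kq + 7) + n * (n * 4 + 8) + 14 <= 60 * (n * l * T))%N.
    have : (n * l * (Kq + 7) <= n * l * (34 * T))%N by rewrite leq_mul2l; lia.
    have : (n * (n * 4 + 8) <= n * (12 * T))%N by rewrite leq_mul2l; lia.
    have : (n * T <= n * l * T)%N by nia.
    have : (T <= n * T)%N by nia.
    by nia.
  apply: (@leq_trans (M * (60 * (n * l * T)))); first by rewrite leq_mul2l inner orbT.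
  by rewrite ME; nia.
have t2 : (n * (16 * N + n * 3 + 6) <= 25 * (T * X))%N.
  apply: (@leq_trans (X * (25 * T))); last by lia.
  by apply: leq_mul => //; lia.
have T0 : (0 < T)%N by lia.
have TX : (X <= T * X)%N by rewrite leq_pmull.
have TT : (T <= T * X)%N by rewrite leq_pmulr.
clearbody M Kq X.
move=> qle tle; split; first by lia.
have qT : (q * T <= 130 * (T * X))%N.
  apply: (@leq_trans (130 * X * T)); last by lia.
  by rewrite leq_mul2r; lia.
by lia.
Qed.

Theorem theorem1 (R : realType) :
  exists (A : cmd) (K : nat),
  forall T : (forall n : nat, dag n -> nat -> nat),
  (* T n G m is the time of an inference query, which includes reading it *)
  (forall (n : nat) (G : dag n) (m : nat), (query_size G m <= T n G m)%N) ->
  forall (n l : nat) (G : dag n) (P Q : bayes_net G l) (eps del : rat)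
         (s : memory),
  (0 < n)%N -> 0 < eps -> 0 < del ->
  input_mem P Q eps del s ->
  exists mu : dist config,
    [/\ eval G (l ^ 2) A (start s) mu,
        let d := dTV (bn_prob P) (bn_prob Q) in
        1 - del <= dprob mu (fun c =>
          (d / (1 + eps) <= output c) && (output c <= (1 + eps) * d)),
        dall mu (fun c =>
          (queries c)%:R <= K%:R * cost_bound R n l eps del) &
        dall mu (fun c =>
          (running_time (T n G (l ^ 2)%N) c)%:R
            <= K%:R * ((T n G (l ^ 2)%N)%:R * cost_bound R n l eps del))].
Proof.
have [C costC] := running_time_bound.
exists estimate, (C * 16)%N => T leT n l G P Q eps del s n0 eps0 del0 inp.
have l0 := alphabet_gt0 n0 P.
have [j lej] := least_inverse_exists eps0; have [e lee] := least_log_exists del0.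
(* A row takes 6 l^2 + 4 l + 4 <= 14 l^2 steps, and a table of D rows has D l^2 entries, all counted
   in the query size. *)
have leK0 i : ((l ^ 2) ^ #|parents G i| * (l * (l * 6 + 2).+2 + 2).+2 + 2 <=
    16 * query_size G (l ^ 2))%N.
  have := query_size_ge G (l ^ 2) i; rewrite expnSr.
  set D := (_ ^ #|_|)%N => DN; have D0 : (0 < D)%N by rewrite !expn_gt0 l0.
  have : (D * (l * (l * 6 + 2).+2 + 2).+2 <= D * (14 * l ^ 2))%N.
    by rewrite leq_pmul2l // -mulnn; nia.
  have : (1 <= D * l ^ 2)%N by rewrite muln_gt0 D0 expn_gt0 l0.
  by lia.
have [mu [ev all mu1 mgf]] := wp_estimate l0 inp lej lee leK0 0 0.
have [j0 jeps _] := lej; have [edel _] := lee.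
have X_le := sample_size_le R n l eps0 del0 lej lee.
have cost c := @costC n l j e (query_size G (l ^ 2)) (T n G (l ^ 2)%N)
  (queries c) (steps c) n0 l0 j0 (query_size_ge_sum _ _) (leT _ _ _).
exists mu; split=> //.
- apply: (estimate_accuracy (X := fun c => nmem (mem_of c) vCnt 0 0) R erefl n0 j0 eps0
    del0 jeps edel _ (dTV_le_sum_excess P Q) (sum_excess_le l0 P Q) _ mu1 _ mgf).
  + by rewrite dTVE; apply: sumr_ge0 => x _; rewrite le_max lexx.
  + by move=> o /all[].
  + by move=> o /all[].
- move=> o /all[_ _ st qu]; have [qC _] := cost o.2 qu st.
  apply: (@le_trans _ _ (C * (n ^ 3 * (j * j) * l * (e + 1)))%N%:R).
    by rewrite ler_nat.
  by rewrite natrM [in leRHS]natrM -mulrA ler_wpM2l.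
- move=> o /all[_ _ st qu]; have [_ tC] := cost o.2 qu st.
  apply: (@le_trans _ _ (C * (T n G (l ^ 2)%N * (n ^ 3 * (j * j) * l * (e + 1))))%N%:R).
    by rewrite ler_nat.
  rewrite natrM [in leRHS]natrM -mulrA ler_wpM2l // natrM mulrCA.
  by rewrite ler_wpM2l.
Qed.
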